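(* Let $(X_j)_{j\ge1}$ be independent, centered, square integrable real random variables on a probability space. Suppose that there is a non-decreasing function $a$ on $[0,1]$ such that for every $t\in[0,1]$, $$\frac{s_{[nt]}^2}{s_n^2}\longrightarrow a(t)\quad\text{as } n\to+\infty,$$ and that the Lindeberg condition holds: for every $\varepsilon>0$, $$\frac{1}{s_n^2}\sum_{j=1}^n\int_{\{|X_j|\ge\varepsilon s_n\}}X_j^2\,d\mathbb{P}\longrightarrow0\quad\text{as } n\to+\infty .$$ Then the sequence of stochastic processes $\{Y_n(t),\,0\le t\le1\}$ converges weakly in finite distributions (i.e. all finite-dimensional marginals converge in distribution) to $\{W(a(t)),\,0\le t\le1\}$, where $\{W(t),\,0\le t\le 1\}$ is a standard Wiener process.
   Context: Notation: $S_0=0$, $S_n=\sum_{k=1}^nX_k$, $s_0=0$, $s_n^2=\sum_{k=1}^n\mathbb{E}(X_k^2)=\mathrm{Var}(S_n)$ with $s_n> 0$ (for $n$ large enough), $[x]$ is the integer part of $x$, and $$Y_n(t)=\frac{S_{[nt]}}{s_n}\mathbf 1_{\{nt\ge1\}},\quad t\in[0,1].$$ *)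

(* Defs.v *)
From HB Require Import structures.
From mathcomp Require Import all_boot all_order all_algebra.
From mathcomp Require Import finmap.
From mathcomp Require Import all_classical all_reals all_analysis.

Set Implicit Arguments.
Unset Strict Implicit.
Unset Printing Implicit Defensive.

Import Order.TTheory GRing.Theory Num.Theory.
Import numFieldNormedType.Exports.

Local Open Scope classical_set_scope.
Local Open Scope ring_scope.

(* Mutual independence of (X i), i in D, by the product rule over every finite
   subfamily. Measurability of the X i is not part of the definition. *)
Definition independent_family (R : realType) (d : measure_display)
    (T : measurableType d) (P : probability T R)
    (I : choiceType) (D : set I) (X : I -> T -> R) : Prop :=
  forall J : {fset I}, [set` J] `<=` D ->
  forall E : I -> set R, (forall i, measurable (E i)) ->
  (P (\bigcap_(i in [set` J]) (X i @^-1` E i)) =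
   \prod_(i <- J) P (X i @^-1` E i))%E.

(* Convergence in distribution of k-dimensional random vectors, tested against
   bounded continuous functions; the limit may live on another space. *)
Definition cvg_in_distribution (R : realType)
    (d : measure_display) (T : measurableType d) (P : probability T R)
    (d' : measure_display) (T' : measurableType d') (P' : probability T' R)
    (k : nat) (Z : nat -> T -> 'rV[R]_k) (Zoo : T' -> 'rV[R]_k) : Prop :=
  forall f : 'rV[R]_k -> R, continuous f -> bounded_fun f ->
  'E_P[fun w => f (Z n w)]%E @[n --> \oo] --> 'E_P'[fun w => f (Zoo w)]%E.

(* The times t i need not be sorted or distinct. *)
Definition cvg_fdd (R : realType)
    (d : measure_display) (T : measurableType d) (P : probability T R)
    (d' : measure_display) (T' : measurableType d') (P' : probability T' R)
    (Y : nat -> R -> T -> R) (Z : R -> T' -> R) : Prop :=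
  forall (k : nat) (t : 'I_k -> R), (forall i, t i \in `[0, 1]) ->
  cvg_in_distribution P P'
    (fun n w => \row_i Y n (t i) w) (fun w => \row_i Z (t i) w).

(* Standard Wiener process on the time interval [0, 1]; nothing is required of
   W t for t outside [0, 1]. The parameter of [normal_prob] is the standard
   deviation, and (for sd 0) it is not a Dirac mass, whence s < t. *)
Definition standard_wiener (R : realType) (d : measure_display)
    (T : measurableType d) (P : probability T R) (W : R -> T -> R) : Prop :=
  [/\ forall t : R, t \in `[0, 1] -> measurable_fun setT (W t),
      {ae P, forall w, W 0 w = 0},
      forall (m : nat) (t : nat -> R), 0 <= t 0%N -> t m <= 1 ->
        (forall i, (i < m)%N -> t i <= t i.+1) ->
        independent_family P [set: 'I_m] (fun i => W (t i.+1) \- W (t i)),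
      forall s t : R, 0 <= s -> s < t -> t <= 1 ->
        forall A : set R, measurable A ->
        P ((W t \- W s) @^-1` A) = normal_prob 0 (Num.sqrt (t - s)) A
    & {ae P, forall w, {within `[0, 1], continuous (W ^~ w)}}].

Section PartialSums.
Context {R : realType} {d : measure_display} {T : measurableType d}.
Variables (P : probability T R) (X : nat -> T -> R).

(* X is indexed from 1: X 0 is never used. *)
Definition partial_sum (n : nat) (w : T) : R := \sum_(1 <= k < n.+1) X k w.

Definition sum_var (n : nat) : R :=
  \sum_(1 <= k < n.+1) fine 'E_P[fun w => (X k w ^+ 2)%R]%E.

Definition sum_sd (n : nat) : R := Num.sqrt (sum_var n).

Definition sum_process (n : nat) (t : R) (w : T) : R :=
  if 1 <= n%:R * t then partial_sum (Num.truncn (n%:R * t)) w / sum_sd n else 0.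

Definition lindeberg_condition : Prop :=
  forall e : R, 0 < e ->
  (sum_var n)^-1 * \sum_(1 <= j < n.+1)
     \int[P]_(w in [set w | e * sum_sd n <= `|X j w|]) (X j w ^+ 2)
  @[n --> \oo] --> 0.

End PartialSums.

(* Main.v *)
Require Import Defs.
From HB Require Import structures.
From mathcomp Require Import all_boot all_order all_algebra.
From mathcomp Require Import finmap.
From mathcomp Require Import all_classical all_reals all_analysis.
From mathcomp Require Import measurable_realfun.
From mathcomp Require Import ring lra.

Set Implicit Arguments.
Unset Strict Implicit.
Unset Printing Implicit Defensive.

Import Order.TTheory GRing.Theory Num.Theory.
Import numFieldNormedType.Exports.

Local Open Scope classical_set_scope.
Local Open Scope ring_scope.

(** Lindeberg's replacement method, with the Wiener process itself providing the
    gaussian variables that replace the summands.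

    Let r_k = s_k ^ 2 / s_n ^ 2. The increments W (r_k) - W (r_(k-1)), k <= n, are
    independent centered normal variables with the variances of the X_k / s_n,
    and they add up to W (r_[nt]) - W 0 where the X_k / s_n add up to Y_n (t).
    The law of the vector (Y_n (t_i))_i is thus compared with that of
    (W (r_[n t_i]))_i, whatever the order of the times t_i, and no gaussian
    vector has to be constructed or identified. Since r_[nt] tends to a (t) and
    W has continuous paths, the latter vector converges almost surely to
    (W (a (t_i)))_i ([wiener_row_limit]).

    The comparison is made on characters cos (u . x + b). A linear combination
    of the coordinates is a weighted sum of the n independent summands, so that
    the replacement of the summands one at a time costs at most the sum of the
    distances between their characteristic functions ([swap_sum]). Each of the
    latter is within an error term of 1 - v / 2, for v the common variance of
    the two summands: Lindeberg's condition controls the error for X_k / s_n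
    ([summand_cf_le]), and for the increments it is of order v ^ (3 / 2)
    ([gaussian_cf_le]), which sums up to little because Lindeberg's condition
    also makes the largest v small ([variance_le_lindeberg]).

    The passage from characters to a bounded continuous f is elementary as well:
    f is within e * (1 + |x| ^ 2) of a trigonometric polynomial, on the whole
    space ([trig_poly_approx]), and the second moments of both vectors are
    bounded. *)

(** * Taylor estimates for exp, sin and cos *)

Section elementary.
Context {R : realType}.
Implicit Types x y z : R.

(** The mean value theorem on either side of 0, for a monotone bound B on the
    derivative; iterating it yields the Taylor estimates below. *)
Lemma increment_le (f df B : R -> R) y :
  f 0 = 0 -> (forall z, is_derive z 1 f (df z)) ->
  (forall s t : R, 0 <= s -> s <= t -> B s <= B t) ->
  (forall z, `|df z| <= B `|z|) ->
  `|f y| <= B `|y| * `|y|.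
Proof.
move=> f0 fdf Bmono dfle.
have cf : continuous f.
  by move=> z; apply/differentiable_continuous/derivable1_diffP/ex_derive.
have wc a b : {within `[a, b], continuous f} by exact: continuous_subspaceT.
have [c cy fyE] : exists2 c, `|c| <= `|y| & f y = df c * y.
  have [y0|y0] := leP 0 y.
    have [c] := MVT_segment y0 (fun z _ => fdf z) (wc 0 y).
    rewrite in_itv/= => /andP[c0 cy]; rewrite f0 !subr0 => ->.
    by exists c => //; rewrite !ger0_norm.
  have [c] := MVT_segment (ltW y0) (fun z _ => fdf z) (wc y 0).
  rewrite in_itv/= => /andP[yc c0]; rewrite f0 !sub0r mulrN => /oppr_inj ->.
  by exists c => //; rewrite !ler0_norm ?lerN2// ltW.
rewrite fyE normrM ler_wpM2r//; apply: le_trans (dfle c) _.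
exact: Bmono.
Qed.

Lemma normr_expR_taylor2 y :
  `|expR y - 1 - y - y ^+ 2 / 2| <= `|y| ^+ 3 * expR `|y|.
Proof.
have mono n (s t : R) : 0 <= s -> s <= t -> s ^+ n * expR s <= t ^+ n * expR t.
  move=> s0 st; apply: ler_pM; rewrite ?exprn_ge0 ?expR_ge0 ?ler_expR//.
  by rewrite lerXn2r// nnegrE// (le_trans s0).
have tayl0 z : `|expR z - 1| <= `|z| ^+ 1 * expR `|z|.
  rewrite [X in X * _]expr1 mulrC -[expR `|z|]mul1r -(expr0 `|z|).
  apply: (@increment_le (fun y => expR y - 1) expR
    (fun t => t ^+ 0 * expR t)).
  - by rewrite expR0; ring.
  - by move=> t; apply: is_derive_eq; rewrite /GRing.scale/=; ring.
  - exact: mono.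
  - by move=> t; rewrite expr0 mul1r ger0_norm ?expR_ge0// ler_expR ler_norm.
have tayl1 z : `|expR z - 1 - z| <= `|z| ^+ 2 * expR `|z|.
  rewrite exprSr mulrAC.
  apply: (@increment_le (fun y => expR y - 1 - y) (fun y => expR y - 1)
    (fun t => t ^+ 1 * expR t)) => //.
  - by rewrite expR0; ring.
  - by move=> t; apply: is_derive_eq; rewrite /GRing.scale/=; ring.
  - exact: mono.
rewrite (exprSr `|y|) [leRHS]mulrAC.
apply: (@increment_le (fun y => expR y - 1 - y - y ^+ 2 / 2)
  (fun y => expR y - 1 - y) (fun t => t ^+ 2 * expR t)) => //.
- by rewrite expR0; ring.
- by move=> t; apply: is_derive_eq; rewrite /GRing.scale/=; field.
- exact: mono.
Qed.

Lemma normr_sin_le x : `|sin x| <= `|x|.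
Proof.
rewrite -[leRHS]mul1r.
apply: (@increment_le sin cos (fun=> 1)) => //.
- exact: sin0.
- by move=> z; exact: cos_max.
Qed.

Lemma cos_dbl_half x : cos x = 1 - 2 * sin (x / 2) ^+ 2.
Proof.
have {1}-> : x = (x / 2) *+ 2 by rewrite -mulr_natr; field.
by rewrite cos_mulr2n cos2sin2 -[_ *+ 2]mulr_natr; ring.
Qed.

Lemma sin_half_sqr_le x : sin (x / 2) ^+ 2 <= x ^+ 2 / 4.
Proof.
have h := normr_sin_le (x / 2).
have -> : x ^+ 2 / 4 = (x / 2) ^+ 2 by field.
by rewrite -[leLHS]real_normK ?num_real// -[leRHS]real_normK ?num_real// lerXn2r ?nnegrE.
Qed.

Lemma normr_sinB_le3 x : `|sin x - x| <= `|x| ^+ 3 / 2.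
Proof.
have -> : `|x| ^+ 3 / 2 = `|x| ^+ 2 / 2 * `|x| by field.
apply: (@increment_le (fun x => sin x - x) (fun x => cos x - 1)
  (fun t => t ^+ 2 / 2)).
- by rewrite sin0 subr0.
- by move=> s t s0 st; rewrite ler_pM2r// lerXn2r// nnegrE// (le_trans s0).
- move=> z; rewrite real_normK ?num_real// cos_dbl_half.
  have := sin_half_sqr_le z; have := sqr_ge0 (sin (z / 2)).
  by rewrite ler_norml; lra.
Qed.

Lemma normr_sinB_le2 x : `|sin x - x| <= `|x| ^+ 2.
Proof.
have h3 := normr_sinB_le3 x.
have h1 : `|sin x - x| <= 2 * `|x|.
  by rewrite (le_trans (ler_normB _ _))// mulr_natl mulr2n lerD2r normr_sin_le.
have := normr_ge0 x; move: h1 h3; set t : R := `|x|; set u : R := `|_ - _| => h1 h3 t0.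
have [t2|t2] := leP t 2.
  by apply: le_trans h3 _; rewrite ler_pdivrMr// exprSr ler_wpM2l// exprn_ge0.
by apply: le_trans h1 _; rewrite expr2 ler_wpM2r// ltW.
Qed.

Lemma normr_cosB_le2 x : `|cos x - 1 + x ^+ 2 / 2| <= x ^+ 2 / 2.
Proof.
rewrite cos_dbl_half; have := sin_half_sqr_le x.
by have := sqr_ge0 (sin (x / 2)); rewrite ler_norml; lra.
Qed.

(** The two factors of sin (x / 2) ^ 2 - (x / 2) ^ 2 are of orders 3 and 1. *)
Lemma normr_cosB_le4 x : `|cos x - 1 + x ^+ 2 / 2| <= `|x| ^+ 4 / 8.
Proof.
have h3 := normr_sinB_le3 (x / 2); have h1 := normr_sin_le (x / 2).
rewrite cos_dbl_half.
have -> : 1 - 2 * sin (x / 2) ^+ 2 - 1 + x ^+ 2 / 2 =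
  - (2 * ((sin (x / 2) - x / 2) * (sin (x / 2) + x / 2))) by field.
have n2 : `|x / 2| = `|x| / 2 by rewrite normrM normfV normr_nat.
rewrite normrN !normrM normr_nat.
have -> : `|x| ^+ 4 / 8 = 2 * ((`|x| / 2) ^+ 3 / 2 * (2 * (`|x| / 2))) by field.
rewrite ler_pM2l// ler_pM// -?n2//.
by rewrite (le_trans (ler_normD _ _))// mulr_natl mulr2n lerD2r.
Qed.

Lemma normr_cosB_le3 x : `|cos x - 1 + x ^+ 2 / 2| <= `|x| ^+ 3 / 2.
Proof.
have h4 := normr_cosB_le4 x; have h2 := normr_cosB_le2 x.
rewrite -[x ^+ 2 in leRHS]real_normK ?num_real// in h2.
have := normr_ge0 x; move: h2 h4; set t : R := `|x|; set u : R := `|_ + _| => h2 h4 t0.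
have [t1|t1] := leP t 1.
  apply: le_trans h4 _.
  have : t ^+ 4 <= t ^+ 3 by rewrite exprSr ler_piMr// exprn_ge0.
  by have := exprn_ge0 3 t0; lra.
apply: le_trans h2 _; rewrite ler_pM2r// [leRHS]exprSr ler_peMr// ?ltW//.
by rewrite exprn_gt0// (lt_trans _ t1).
Qed.

(** This dominates the Taylor remainders of cos and sin of order two: it is
    small with e where |x| < e and merely quadratic elsewhere, so that its mean
    has the two terms of Lindeberg's estimate. *)
Definition lindeberg_weight (e x : R) : R := e * x ^+ 2 + (if e <= `|x| then x ^+ 2 else 0).

Lemma lindeberg_weight_ge (e x u : R) : 0 < e ->
  u <= `|x| ^+ 3 / 2 -> u <= `|x| ^+ 2 -> u <= lindeberg_weight e x.
Proof.
move=> e0 u3 u2; rewrite /lindeberg_weight -[x ^+ 2]real_normK ?num_real//.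
have t0 := normr_ge0 x; move: u2 u3 t0; set t : R := `|x| => u2 u3 t0.
have t2 : 0 <= t ^+ 2 by exact: exprn_ge0.
case: ifPn => [_|]; first by rewrite (le_trans u2)// lerDr mulr_ge0// ltW.
rewrite -ltNge addr0 => xe; apply: le_trans u3 _.
have : t ^+ 3 <= e * t ^+ 2 by rewrite exprS ler_wpM2r// ltW.
by have := exprn_ge0 3 t0; lra.
Qed.

Lemma normr_cosB_weight e x : 0 < e -> `|cos x - 1 + x ^+ 2 / 2| <= lindeberg_weight e x.
Proof.
move=> e0; apply: lindeberg_weight_ge => //; first exact: normr_cosB_le3.
rewrite real_normK ?num_real//; apply: le_trans (normr_cosB_le2 x) _.
by have := sqr_ge0 x; lra.
Qed.

Lemma normr_sinB_weight e x : 0 < e -> `|sin x - x| <= lindeberg_weight e x.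
Proof.
by move=> e0; apply: lindeberg_weight_ge; [|exact: normr_sinB_le3|exact: normr_sinB_le2].
Qed.

End elementary.

(** * Independence of a sum and of the next term *)

Section independence.
Context {R : realType} {d : measure_display} {T : measurableType d}.
Variable P : probability T R.

Definition indep2 (U V : T -> R) : Prop :=
  forall A B : set R, measurable A -> measurable B ->
  (P (U @^-1` A `&` V @^-1` B) = P (U @^-1` A) * P (V @^-1` B))%E.

Lemma dynkin_indep (C : set T) : measurable C ->
  dynkin [set A | measurable A /\ (P (A `&` C) = P A * P C)%E].
Proof.
move=> mC; split.
- by split => //; rewrite setTI probability_setT mul1e.
- move=> A [mA PA]; split; first exact: measurableC.
  have -> : (P (~` A `&` C) = P C - P (A `&` C))%E.
    by rewrite setIC -setDE (setIC A) measureD// ltey_eq fin_num_measure.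
  rewrite PA probability_setC// muleBl ?mul1e ?fin_num_measure//.
- move=> F tF mF; split; first by apply: bigcup_measurable => k _; exact: (mF k).1.
  rewrite setI_bigcupl !measure_bigcup//.
  + have PC : P C \is a fin_num by rewrite fin_num_measure.
    transitivity (\sum_(0 <= i <oo | i \in [set: nat])
        ((fine (P C))%:E * P (F i)))%E.
      by apply: eq_eseriesr => i _; rewrite fineK// muleC; exact: (mF i).2.
    by rewrite nneseriesZl// fineK// muleC.
  + by move=> k _; exact: (mF k).1.
  + by move=> k _; apply: measurableI => //; exact: (mF k).1.
  + exact: trivIset_setIr.
Qed.

Section sum.
Variables (I : choiceType) (D : set I) (X : I -> T -> R).
Hypothesis mX : forall i, D i -> measurable_fun setT (X i).
Hypothesis iX : independent_family P D X.

Let cylinders (J : {fset I}) : set (set T) := [set A | exists2 E : I -> set R,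
  (forall i, measurable (E i)) & A = \bigcap_(i in [set` J]) (X i @^-1` E i)].

Let cylinders_setI J : setI_closed (cylinders J).
Proof.
move=> _ _ [E mE ->] [F mF ->]; exists (fun i => E i `&` F i).
  by move=> i; exact: measurableI.
by rewrite -bigcapI; apply: eq_bigcapr => i _; rewrite preimage_setI.
Qed.

Let cylinders_indep (J : {fset I}) i (B : set R) : [set` J] `<=` D -> D i ->
  i \notin J -> measurable B ->
  cylinders J `<=` [set A | measurable A /\
    (P (A `&` X i @^-1` B) = P A * P (X i @^-1` B))%E].
Proof.
move=> JD Di iJ mB _ [E mE ->]; split.
  apply: fin_bigcap_measurable => // j /JD Dj.
  by rewrite -[_ @^-1` _]setTI; exact: mX.
have JD' : [set` (i |` J)%fset] `<=` D.
  by move=> j /=; rewrite !inE => /predU1P[->//|]; exact: JD.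
pose F j := if j == i then B else E j.
have FE j : j \in J -> F j = E j.
  by rewrite /F; case: eqP => // -> ij; rewrite ij in iJ.
have mF j : measurable (F j) by rewrite /F; case: ifP.
have := iX JD' mF.
rewrite set_fsetU1 bigcap_setU1 big_fsetU1//= {1 3}/F eqxx.
rewrite (eq_bigcapr (G := fun j => X j @^-1` E j)); last first.
  by move=> j /= jJ; rewrite FE.
rewrite big_seq (eq_bigr (fun j => P (X j @^-1` E j))); last first.
  by move=> j jJ; rewrite FE.
by rewrite -big_seq -(iX JD mE) setIC muleC.
Qed.

Let cylinders_measurable (J : {fset I}) j : j \in J ->
  measurable_fun [set: g_sigma_algebraType (cylinders J)] (X j).
Proof.
move=> jJ _ B mB; rewrite setTI; apply: sub_sigma_algebra.
exists (fun k => if k == j then B else setT); first by move=> k; case: ifP.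
apply/seteqP; split => [w Bw k _ /=|w /(_ j jJ)]; last by rewrite eqxx.
by case: eqP => // ->.
Qed.

(** The sum is measurable for the sigma-algebra generated by the cylinder events
    of the X j, j in s. These form a pi-system of events independent of X i, and
    Dynkin's theorem extends the independence to the sigma-algebra. *)
Lemma indep2_sum (s : seq I) (c : I -> R) i : {in s, forall j, D j} -> D i ->
  i \notin s -> indep2 (fun w => \sum_(j <- s) c j * X j w) (X i).
Proof.
move=> sD Di iNs A B mA mB.
pose J : {fset I} := [fset j in s]%fset.
have mS : measurable_fun [set: g_sigma_algebraType (cylinders J)]
    (fun w => \sum_(j <- s) c j * X j w).
  have : {subset s <= J} by move=> j; rewrite inE.
  elim: (s) => [|j r ih] rJ.
    by under eq_fun do rewrite big_nil; exact: measurable_cst.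
  under eq_fun do rewrite big_cons.
  apply: measurable_funD.
    apply: measurable_funM; first exact: measurable_cst.
    by apply: cylinders_measurable; rewrite rJ// mem_head.
  by apply: ih => k kr; rewrite rJ// inE kr orbT.
have sA : <<s cylinders J >> ((fun w => \sum_(j <- s) c j * X j w) @^-1` A).
  by have := mS measurableT A mA; rewrite setTI.
have JD : [set` J] `<=` D by move=> j /=; rewrite inE; exact: sD.
have iJ : i \notin J by rewrite inE.
have mB' : measurable (X i @^-1` B) by rewrite -[_ @^-1` _]setTI; exact: mX.
move: sA; rewrite -setI_closed_g_dynkin_g_sigma_algebra// => sA.
have := smallest_sub (dynkin_indep mB') (cylinders_indep JD Di iJ mB) sA.
by case.
Qed.
End sum.
End independence.

(** * Expectation of a product of independent variables *)

Section expectation.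
Context {R : realType} {d : measure_display} {T : measurableType d}.
Variable P : probability T R.
Implicit Types f g : T -> R.

Lemma integrable_le_bounded (f : T -> R) (M : R) :
  measurable_fun setT f -> (forall w, `|f w| <= M) ->
  P.-integrable setT (EFin \o f).
Proof.
move=> mf fM; apply: measurable_bounded_integrable => //.
  by rewrite ltey_eq fin_num_measure.
exists M; split; first exact: num_real.
by move=> x Mx w _; rewrite /= (le_trans (fM w))// ltW.
Qed.

Lemma Rintegral_dominated (f g : T -> R) : P.-integrable setT (EFin \o f) ->
  P.-integrable setT (EFin \o g) -> (forall w, `|f w| <= g w) ->
  `|\int[P]_w f w| <= \int[P]_w g w.
Proof.
move=> fi gi fg; apply: le_trans (le_normr_Rintegral _ _) _ => //.
apply: le_Rintegral => //; exact: integrable_norm.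
Qed.

Lemma Rintegral_cstT (r : R) : \int[P]_(_ in setT) r = r.
Proof. by rewrite Rintegral_cst//= probability_setT mulr1. Qed.

Lemma EFin_Rintegral (f : T -> R) : P.-integrable setT (EFin \o f) ->
  ((\int[P]_w f w)%:E = \int[P]_w (f w)%:E)%E.
Proof. by move=> fi; rewrite fineK// integrable_fin_num. Qed.

Let law (U : T -> R) (mU : measurable_fun setT U) : probability R R :=
  distribution P (mfun_Sub (mem_set mU)).

Lemma indep2_law (U V : T -> R) (mU : measurable_fun setT U)
    (mV : measurable_fun setT V) (W : {mfun T >-> (R * R)%type}) :
  (forall w, W w = (U w, V w)) -> indep2 P U V ->
  forall A : set (R * R), measurable A ->
  (distribution P W A = (law mU \x law mV) A)%E.
Proof.
move=> WE iUV A mA; rewrite (@product_measure_unique _ _ _ _ _ (law mU) (law mV)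
  (distribution P W))// => B C mB mC.
rewrite /distribution /pushforward.
by rewrite -iUV//; congr (P _); apply/seteqP; split => w /=; rewrite WE.
Qed.

Lemma law_integrable (U : T -> R) (mU : measurable_fun setT U) (f : R -> R) :
  measurable_fun setT f -> P.-integrable setT (EFin \o (f \o U)) ->
  (law mU).-integrable setT (EFin \o f).
Proof.
move=> mf fi; apply: (integrable_pushforward (phi := U)) => //.
exact/measurable_EFinP.
Qed.

Lemma law_integral (U : T -> R) (mU : measurable_fun setT U) (f : R -> R) :
  measurable_fun setT f -> P.-integrable setT (EFin \o (f \o U)) ->
  (\int[law mU]_x (f x)%:E = \int[P]_w (f (U w))%:E)%E.
Proof.
move=> mf fi; rewrite /law integral_distribution//.
exact/measurable_EFinP.
Qed.

(** Fubini for the joint law of two independent variables. *)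
Lemma indep2_mul (U V : T -> R) (f g : R -> R) :
  measurable_fun setT U -> measurable_fun setT V ->
  measurable_fun setT f -> measurable_fun setT g -> indep2 P U V ->
  P.-integrable setT (EFin \o (f \o U)) ->
  P.-integrable setT (EFin \o (g \o V)) ->
  P.-integrable setT (EFin \o (fun w => f (U w) * g (V w))) /\
  \int[P]_w (f (U w) * g (V w)) = \int[P]_w f (U w) * \int[P]_w g (V w).
Proof.
move=> mU mV mf mg iUV fi gi.
have mUV : measurable_fun setT (fun w => (U w, V w)).
  exact: measurable_fun_pair.
pose W : {mfun T >-> (R * R)%type} := mfun_Sub (mem_set mUV).
have WE := @indep2_law U V mU mV W (fun=> erefl) iUV.
pose h (p : R * R) : \bar R := (f p.1 * g p.2)%:E.
have mh : measurable_fun setT h.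
  apply/measurable_EFinP; apply: measurable_funM.
    by apply: (measurableT_comp mf); exact: measurable_fst.
  by apply: (measurableT_comp mg); exact: measurable_snd.
have fi' := law_integrable mU mf fi; have gi' := law_integrable mV mg gi.
have mnorm (k : R -> R) : measurable_fun setT k ->
    measurable_fun setT (fun x => `|k x|%:E).
  by move=> mk; apply/measurable_EFinP; apply: measurableT_comp.
have hi : (law mU \x law mV)%E.-integrable setT h.
  apply/integrable12ltyP => //.
  rewrite (eq_integral (fun x => \int[law mV]_y `|(g y)%:E| * `|(f x)%:E|)%E).
    rewrite ge0_integralZl//=; [|exact: mnorm|exact: integral_ge0].
    by rewrite lte_mul_pinfty ?integral_ge0 ?ge0_fin_numE ?integral_ge0//;
        [case/integrableP : gi'|case/integrableP : fi'].
  move=> x _; rewrite muleC -ge0_integralZl//=; last exact: mnorm.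
  by apply: eq_integral => y _; rewrite normrM EFinM.
have Wh : P.-integrable setT (h \o W).
  apply/integrableP; split; first exact: measurableT_comp.
  have := hi => /integrableP[_]; congr (_ < _)%E.
  have <- := @eq_measure_integral _ _ _ setT _ _ (abse \o h)
    (fun A mA _ => WE A mA).
  have mah : measurable_fun setT (abse \o h) by exact: measurableT_comp.
  by apply: (ge0_integral_distribution W mah) => y; exact: abse_ge0.
split=> //; apply: EFin_inj; rewrite EFinM !EFin_Rintegral//.
rewrite -(law_integral mU mf fi) -(law_integral mV mg gi).
rewrite -[LHS](integral_distribution (X := W) mh Wh).
rewrite (eq_measure_integral (law mU \x law mV)%E); last by move=> A mA _; exact: WE.
rewrite -integral12_prod_meas1//.
rewrite (eq_integral (fun x => (\int[law mV]_y (g y)%:E) * (f x)%:E)%E).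
  have gf : (\int[law mV]_y (g y)%:E)%E \is a fin_num by exact: integrable_fin_num gi'.
  by rewrite -(fineK gf) integralZl// muleC.
by move=> x _; rewrite muleC -integralZl.
Qed.

End expectation.

(** * Replacement of the summands in a characteristic function *)

Section trig_expectation.
Context {R : realType} {d : measure_display} {T : measurableType d}.
Variable P : probability T R.

Lemma measurable_cos : measurable_fun setT (@cos R).
Proof. by apply: continuous_measurable_fun; exact: continuous_cos. Qed.

Lemma measurable_sin : measurable_fun setT (@sin R).
Proof. by apply: continuous_measurable_fun; exact: continuous_sin. Qed.

Lemma measurable_cos_comp (U : T -> R) : measurable_fun setT U ->
  measurable_fun setT (fun w => cos (U w)).
Proof. by move=> mU; exact: (measurableT_comp measurable_cos). Qed.

Lemma measurable_sin_comp (U : T -> R) : measurable_fun setT U ->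
  measurable_fun setT (fun w => sin (U w)).
Proof. by move=> mU; exact: (measurableT_comp measurable_sin). Qed.

Lemma integrable_cos (U : T -> R) : measurable_fun setT U ->
  P.-integrable setT (EFin \o (fun w => cos (U w))).
Proof.
move=> mU; apply: (@integrable_le_bounded _ _ _ P _ 1).
- exact: measurable_cos_comp.
- by move=> w; exact: cos_max.
Qed.

Lemma integrable_sin (U : T -> R) : measurable_fun setT U ->
  P.-integrable setT (EFin \o (fun w => sin (U w))).
Proof.
move=> mU; apply: (@integrable_le_bounded _ _ _ P _ 1).
- exact: measurable_sin_comp.
- by move=> w; exact: sin_max.
Qed.

Lemma integrableZ_EFin (c : R) (f : T -> R) : P.-integrable setT (EFin \o f) ->
  P.-integrable setT (EFin \o (fun w => c * f w)).
Proof.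
move=> fi; rewrite (_ : _ \o _ = fun w => c%:E * (EFin \o f) w)%E; last first.
  by apply/funext => w /=; rewrite EFinM.
exact: integrableZl.
Qed.

Lemma integrableD_EFin (f g : T -> R) : P.-integrable setT (EFin \o f) ->
  P.-integrable setT (EFin \o g) ->
  P.-integrable setT (EFin \o (fun w => f w + g w)).
Proof.
move=> fi gi; rewrite (_ : _ \o _ = (EFin \o f) \+ (EFin \o g))%E.
  exact: integrableD.
by apply/funext => w /=; rewrite EFinD.
Qed.

Lemma integrableB_EFin (f g : T -> R) : P.-integrable setT (EFin \o f) ->
  P.-integrable setT (EFin \o g) ->
  P.-integrable setT (EFin \o (fun w => f w - g w)).
Proof.
move=> fi gi; rewrite (_ : _ \o _ = (EFin \o f) \- (EFin \o g))%E.
  exact: integrableB.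
by apply/funext => w /=; rewrite EFinB.
Qed.

Lemma Rintegral_cosD_cst (U : T -> R) (b y : R) : measurable_fun setT U ->
  \int[P]_w cos (U w + (b + y)) =
  (\int[P]_w cos (U w + b)) * cos y - (\int[P]_w sin (U w + b)) * sin y.
Proof.
move=> mU; have mUb : measurable_fun setT (fun w => U w + b).
  exact: measurable_funD.
under eq_Rintegral do rewrite addrA cosD.
have ci := integrable_cos mUb; have si := integrable_sin mUb.
rewrite RintegralB ?RintegralZr//.
- under [X in integrable _ _ X]eq_fun do rewrite /= mulrC.
  exact: integrableZ_EFin.
- under [X in integrable _ _ X]eq_fun do rewrite /= mulrC.
  exact: integrableZ_EFin.
Qed.

(** The real part of the multiplicativity of characteristic functions. *)
Lemma indep2_cosD (U V : T -> R) (b : R) :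
  measurable_fun setT U -> measurable_fun setT V -> indep2 P U V ->
  \int[P]_w cos (U w + V w + b) =
  (\int[P]_w cos (U w + b)) * (\int[P]_w cos (V w)) -
  (\int[P]_w sin (U w + b)) * (\int[P]_w sin (V w)).
Proof.
move=> mU mV iUV; have mUb : measurable_fun setT (fun w => U w + b).
  exact: measurable_funD.
have mb : measurable_fun setT (fun x : R => x + b) by exact: measurable_funD.
have mcb : measurable_fun setT (fun x : R => cos (x + b)).
  exact: (measurableT_comp measurable_cos).
have msb : measurable_fun setT (fun x : R => sin (x + b)).
  exact: (measurableT_comp measurable_sin).
have [cci <-] := indep2_mul mU mV mcb measurable_cos iUV
  (integrable_cos mUb) (integrable_cos mV).
have [ssi <-] := indep2_mul mU mV msb measurable_sin iUV
  (integrable_sin mUb) (integrable_sin mV).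
rewrite -RintegralB//; apply: eq_Rintegral => w _.
by rewrite addrAC (cosD (U w + b)).
Qed.

End trig_expectation.

Section swap.
Context {R : realType} {d d' : measure_display}.
Context {T : measurableType d} {T' : measurableType d'}.
Variables (P : probability T R) (P' : probability T' R).

Definition cf_dist (U : T -> R) (V : T' -> R) : R :=
  `|\int[P]_w cos (U w) - \int[P']_w cos (V w)| +
  `|\int[P]_w sin (U w) - \int[P']_w sin (V w)|.

(** One replacement costs the distance between the characteristic functions of
    X and Y. The uniformity in b is what makes this work by induction: the
    replacement of U by V is used at the random phase b + Y. *)
Lemma swap_step (U X : T -> R) (V Y : T' -> R) (e : R) :
  measurable_fun setT U -> measurable_fun setT X ->
  measurable_fun setT V -> measurable_fun setT Y ->
  indep2 P U X -> indep2 P' V Y ->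
  (forall b, `|\int[P]_w cos (U w + b) - \int[P']_w cos (V w + b)| <= e) ->
  forall b, `|\int[P]_w cos (U w + X w + b) -
              \int[P']_w cos (V w + Y w + b)| <= e + cf_dist X Y.
Proof.
move=> mU mX mV mY iUX iVY UV b.
rewrite !indep2_cosD//.
have mUb : measurable_fun setT (fun w => U w + b) by exact: measurable_funD.
set Cu := \int[P]_w cos (U w + b); set Su := \int[P]_w sin (U w + b).
set Cv := \int[P']_w cos (V w + b); set Sv := \int[P']_w sin (V w + b).
set cx := \int[P]_w cos (X w); set sx := \int[P]_w sin (X w).
set cy := \int[P']_w cos (Y w); set sy := \int[P']_w sin (Y w).
have Cu1 : `|Cu| <= 1.
  rewrite -(Rintegral_cstT P 1); apply: Rintegral_dominated.
  - exact: integrable_cos.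
  - exact: finite_measure_integrable_cst.
  - by move=> w; exact: cos_max.
have Su1 : `|Su| <= 1.
  rewrite -(Rintegral_cstT P 1); apply: Rintegral_dominated.
  - exact: integrable_sin.
  - exact: finite_measure_integrable_cst.
  - by move=> w; exact: sin_max.
have mixY : `|(Cu - Cv) * cy - (Su - Sv) * sy| <= e.
  rewrite /cy /sy -!RintegralZl//; [|exact: integrable_sin|exact: integrable_cos].
  rewrite -RintegralB//; last 2 first.
  - by apply: integrableZ_EFin; exact: integrable_cos.
  - by apply: integrableZ_EFin; exact: integrable_sin.
  rewrite -(Rintegral_cstT P' e); apply: Rintegral_dominated.
  - by apply: integrableB_EFin; apply: integrableZ_EFin;
      [exact: integrable_cos|exact: integrable_sin].
  - exact: finite_measure_integrable_cst.
  move=> w; apply: le_trans (UV (b + Y w)).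
  rewrite !Rintegral_cosD_cst// -/Cu -/Su -/Cv -/Sv.
  by rewrite le_eqVlt; apply/orP; left; apply/eqP; congr `|_|; ring.
have -> : Cu * cx - Su * sx - (Cv * cy - Sv * sy) =
  ((Cu - Cv) * cy - (Su - Sv) * sy) + (Cu * (cx - cy) - Su * (sx - sy)) by ring.
apply: le_trans (ler_normD _ _) _; apply: lerD => //.
apply: le_trans (ler_normB _ _) _; rewrite /cf_dist -/cx -/sx -/cy -/sy !normrM.
by apply: lerD; rewrite -[leRHS]mul1r ler_wpM2r.
Qed.

Lemma swap_sum (X : nat -> T -> R) (Y : nat -> T' -> R) (n : nat) :
  (forall k, (k < n)%N -> measurable_fun setT (X k)) ->
  (forall k, (k < n)%N -> measurable_fun setT (Y k)) ->
  (forall k, (k < n)%N -> indep2 P (fun w => \sum_(0 <= j < k) X j w) (X k)) ->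
  (forall k, (k < n)%N -> indep2 P' (fun w => \sum_(0 <= j < k) Y j w) (Y k)) ->
  forall b, `|\int[P]_w cos (\sum_(0 <= j < n) X j w + b) -
              \int[P']_w cos (\sum_(0 <= j < n) Y j w + b)|
    <= \sum_(0 <= k < n) cf_dist (X k) (Y k).
Proof.
have msum e (S : measurableType e) (Z : nat -> S -> R) m :
    (forall k, (k < m)%N -> measurable_fun setT (Z k)) ->
    measurable_fun setT (fun w => \sum_(0 <= j < m) Z j w).
  elim: m => [|m ih] mZ.
    by under eq_fun do rewrite big_nil; exact: measurable_cst.
  under eq_fun do rewrite big_nat_recr//=.
  by apply: measurable_funD; [apply: ih => k km; exact/mZ/ltnW|exact: mZ].
elim: n => [|n ih] mX mY iX iY b.
  rewrite big_nil.
  under eq_Rintegral do rewrite big_nil.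
  rewrite Rintegral_cstT.
  under eq_Rintegral do rewrite big_nil.
  by rewrite Rintegral_cstT subrr normr0.
have sub k : (k < n)%N -> (k < n.+1)%N by move=> kn; exact: ltnW.
rewrite big_nat_recr//=.
under eq_Rintegral do rewrite big_nat_recr//=.
under [X in _ - X]eq_Rintegral do rewrite big_nat_recr//=.
apply: swap_step.
- by apply: msum => k /sub; exact: mX.
- exact: mX.
- by apply: msum => k /sub; exact: mY.
- exact: mY.
- exact: iX.
- exact: iY.
- by apply: ih => k /sub; [exact: mX|exact: mY|exact: iX|exact: iY].
Qed.

End swap.

(** * Centered normal variables *)

Section normal_mgf.
Context {R : realType}.
Local Notation mu := (@lebesgue_measure R).

Lemma ge0_integral_normal_prob (s : R) (f : R -> \bar R) :
  measurable_fun setT f -> (forall x, (0 <= f x)%E) ->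
  (\int[normal_prob 0 s]_x f x = \int[mu]_x (f x * (normal_pdf 0 s x)%:E))%E.
Proof.
move=> mf f0; have dom := @normal_prob_dominates R 0 s.
rewrite -(Radon_Nikodym_SigmaFinite.change_of_variables dom)//.
have mg := measurable_int _ (Radon_Nikodym_SigmaFinite.f_integrable dom).
have mp : measurable_fun setT (fun x => (normal_pdf 0 s x)%:E).
  by apply/measurable_EFinP; exact: measurable_normal_pdf.
apply: ae_eq_integral => //.
- exact: emeasurable_funM.
- exact: emeasurable_funM.
- apply: ae_eqe_mul2l; apply: integral_ae_eq => //.
    exact: Radon_Nikodym_SigmaFinite.f_integrable.
  by move=> E _ mE; rewrite -Radon_Nikodym_SigmaFinite.f_integral.
Qed.

(** Completing the square turns the exponential tilting of a centered normal
    density into a translate of it. *)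
Lemma normal_mgf (s l : R) : s != 0 ->
  (\int[normal_prob 0 s]_x (expR (l * x))%:E =
   (expR (l ^+ 2 * s ^+ 2 / 2))%:E)%E.
Proof.
move=> s0; rewrite ge0_integral_normal_prob; last 2 first.
- apply/measurable_EFinP; apply: (measurableT_comp (@measurable_expR R)).
  exact: measurable_funM.
- by move=> x; rewrite lee_fin expR_ge0.
transitivity (\int[mu]_x ((expR (l ^+ 2 * s ^+ 2 / 2))%:E *
    (normal_pdf (l * s ^+ 2) s x)%:E))%E.
  apply: eq_integral => x _; rewrite -!EFinM; congr EFin.
  rewrite !normal_pdfE// mulrCA [RHS]mulrCA /normal_fun -!expRD.
  congr (_ * expR _); rewrite -[s ^+ 2 *+ 2]mulr_natr; field.
  by rewrite s0.
rewrite integralZl//; last exact: integrable_normal_pdf.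
by rewrite integral_normal_pdf mule1.
Qed.

End normal_mgf.

Section gaussian.
Context {R : realType} {d : measure_display} {T : measurableType d}.
Variable P : probability T R.

(** Y is a centered normal variable of variance v, possibly 0; normality is
    encoded by the moment generating function so as to include v = 0. *)
Definition gaussian (Y : T -> R) (v : R) : Prop :=
  measurable_fun setT Y /\ forall l,
  (\int[P]_w (expR (l * Y w))%:E = (expR (l ^+ 2 * v / 2))%:E)%E.

Lemma gaussian_cst0 (Y : T -> R) : (forall w, Y w = 0) -> gaussian Y 0.
Proof.
move=> Y0; split.
  by rewrite (_ : Y = cst 0)//; apply/funext.
move=> l; rewrite mulr0 mul0r.
under eq_integral do rewrite Y0 mulr0.
by rewrite expR0 integral_cst//= probability_setT mule1.
Qed.

Lemma gaussianZ (Y : T -> R) (v c : R) :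
  gaussian Y v -> gaussian (fun w => c * Y w) (c ^+ 2 * v).
Proof.
move=> [mY EY]; split; first exact: measurable_funM.
move=> l; under eq_integral do rewrite mulrA.
by rewrite EY; congr (expR _)%:E; ring.
Qed.

Lemma normal_gaussian (Y : T -> R) (v : R) : 0 < v -> measurable_fun setT Y ->
  (forall A, measurable A -> P (Y @^-1` A) = normal_prob 0 (Num.sqrt v) A) ->
  gaussian Y v.
Proof.
move=> v0 mY PY; split=> // l.
have mY' : @measurable_fun _ _ T (measurableTypeR R) setT Y by exact: mY.
pose Y' : {mfun T >-> measurableTypeR R} :=
  @mfun_Sub _ _ T (measurableTypeR R) Y (mem_set mY').
pose f (x : measurableTypeR R) : \bar R := (expR (l * x))%:E.
have mf : measurable_fun setT f.
  apply/measurable_EFinP; apply: (measurableT_comp (@measurable_expR R)).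
  exact: measurable_funM.
have f0 x : (0 <= f x)%E by rewrite lee_fin expR_ge0.
have s0 : Num.sqrt v != 0 by rewrite gt_eqF// sqrtr_gt0.
rewrite -[LHS](ge0_integral_distribution Y' mf f0).
transitivity (\int[normal_prob 0 (Num.sqrt v)]_x f x)%E.
  by apply: eq_measure_integral => A mA _; exact: PY.
by rewrite /f normal_mgf// sqr_sqrtr// ltW.
Qed.

Section gaussian_estimates.
Variables (Y : T -> R) (v : R).
Hypotheses (GY : gaussian Y v) (v0 : 0 <= v) (v1 : v <= 1).

Let mY : measurable_fun setT Y. Proof. by case: GY. Qed.

Let mexpY l : measurable_fun setT (fun w => expR (l * Y w)).
Proof.
apply: (measurableT_comp (@measurable_expR R)); exact: measurable_funM.
Qed.

Let iexpY l : P.-integrable setT (EFin \o (fun w => expR (l * Y w))).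
Proof.
apply/integrableP; split; first exact/measurable_EFinP.
under eq_integral do rewrite /= ger0_norm ?expR_ge0//.
by rewrite GY.2 ltry.
Qed.

Let EexpY l : \int[P]_w expR (l * Y w) = expR (l ^+ 2 * v / 2).
Proof. by rewrite /Rintegral GY.2. Qed.

Let iexp2 l :
  P.-integrable setT (EFin \o (fun w => expR (l * Y w) + expR (- l * Y w))).
Proof. exact: integrableD_EFin. Qed.

Let expR_norm_le (l y : R) : 0 <= l ->
  expR (l * `|y|) <= expR (l * y) + expR (- l * y).
Proof.
move=> l0; have [y0|y0] := leP 0 y.
  by rewrite ger0_norm// lerDl expR_ge0.
by rewrite ltr0_norm// mulrN mulNr lerDr expR_ge0.
Qed.

(** The exponent 1 suffices to bound the second moment when v <= 1. *)
Lemma gaussian_sqr_le : P.-integrable setT (EFin \o (fun w => Y w ^+ 2)) /\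
  \int[P]_w (Y w ^+ 2) <= 4 * expR 1.
Proof.
have le1 w : `|Y w ^+ 2| <= 2 * (expR (1 * Y w) + expR (- 1 * Y w)).
  rewrite ger0_norm ?sqr_ge0//.
  have := expR_norm_le (Y w) ler01; have := @expR_ge1Dxn R `|Y w| 1 (normr_ge0 _).
  rewrite (mul1r `|Y w|) real_normK ?num_real// (_ : 2`! = 2)%N//.
  by lra.
have i1 : P.-integrable setT
    (EFin \o (fun w => 2 * (expR (1 * Y w) + expR (- 1 * Y w)))).
  exact: integrableZ_EFin.
have i2 : P.-integrable setT (EFin \o (fun w => Y w ^+ 2)).
  apply: le_integrable i1 => //.
    by apply/measurable_EFinP; exact: measurable_funX.
  by move=> w _ /=; rewrite lee_fin (le_trans (le1 w))// ler_norm.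
split=> //; apply: le_trans (ler_norm _) _.
apply: le_trans (Rintegral_dominated i2 i1 le1) _.
rewrite RintegralZl// RintegralD// !EexpY sqrrN.
have : expR (1 ^+ 2 * v / 2) <= expR 1.
  by rewrite ler_expR expr1n; have := v1; lra.
by lra.
Qed.

Let q (y : R) : R := `|y| ^+ 3 * expR `|y|.

(* The scale s is to be about the standard deviation: it makes |y| ^ 3 of order
   s ^ 3 times an exponential of y / s, whose mean is bounded. *)
Let q_le (s y : R) : 0 < s ->
  q y <= 6 * s ^+ 3 * (expR ((1 + s^-1) * y) + expR (- (1 + s^-1) * y)).
Proof.
move=> s0.
have m0 : 0 <= 1 + s^-1 by rewrite addr_ge0// invr_ge0 ltW.
apply: le_trans (_ : _ <= 6 * s ^+ 3 * expR ((1 + s^-1) * `|y|)) _; last first.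
  by rewrite ler_wpM2l ?expR_norm_le// mulr_ge0// exprn_ge0// ltW.
have -> : (1 + s^-1) * `|y| = `|y| + s^-1 * `|y| by ring.
rewrite expRD.
rewrite (_ : _ * (_ * _) = 6 * s ^+ 3 * expR (s^-1 * `|y|) * expR `|y|); last ring.
rewrite ler_wpM2r ?expR_ge0//.
have z0 : 0 <= s^-1 * `|y| by rewrite mulr_ge0// invr_ge0 ltW.
have := @expR_ge1Dxn R _ 2 z0; rewrite (_ : 3`! = 6)%N// => h.
have -> : `|y| ^+ 3 = 6 * s ^+ 3 * ((s^-1 * `|y|) ^+ 3 / 6).
  by field; rewrite gt_eqF.
rewrite ler_wpM2l//; first by rewrite mulr_ge0// exprn_ge0// ltW.
by apply: le_trans h; rewrite lerDr.
Qed.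

Let mean_le (h : R -> R) (s : R) : measurable_fun setT h ->
  (forall y, `|h y| <= 2 * q y) -> 0 < s -> s <= 1 -> v <= s ^+ 2 ->
  P.-integrable setT (EFin \o (fun w => h (Y w))) /\
  `|\int[P]_w h (Y w)| <= 24 * expR 2 * s ^+ 3.
Proof.
move=> mh hq s0 s1 vs.
set m := 1 + s^-1.
pose g w := 12 * s ^+ 3 * (expR (m * Y w) + expR (- m * Y w)).
have hg w : `|h (Y w)| <= g w.
  apply: le_trans (hq _) _; rewrite /g.
  by have := q_le (Y w) s0; rewrite -/m; lra.
have gi : P.-integrable setT (EFin \o g) by exact: integrableZ_EFin.
have hi : P.-integrable setT (EFin \o (fun w => h (Y w))).
  apply: le_integrable gi => //.
    by apply/measurable_EFinP; exact: (measurableT_comp mh).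
  by move=> w _ /=; rewrite lee_fin (le_trans (hg w))// ler_norm.
split=> //; apply: le_trans (Rintegral_dominated hi gi hg) _.
rewrite /g RintegralZl// RintegralD// !EexpY sqrrN.
have : expR (m ^+ 2 * v / 2) <= expR 2.
  rewrite ler_expR ler_pdivrMr//.
  apply: le_trans (_ : _ <= m ^+ 2 * s ^+ 2) _; first by rewrite ler_wpM2l ?sqr_ge0.
  rewrite -exprMn /m mulrDl mulVf ?gt_eqF// mul1r.
  have : (s + 1) ^+ 2 <= 2 ^+ 2 by rewrite lerXn2r ?nnegrE//; lra.
  by lra.
have : 0 <= s ^+ 3 by rewrite exprn_ge0// ltW.
move=> s3 h3; have := ler_wpM2l s3 h3; lra.
Qed.

Let cf_le (s : R) : 0 < s -> s <= 1 -> v <= s ^+ 2 ->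
  `|\int[P]_w cos (Y w) - (1 - v / 2)| <= 25 * expR 2 * s ^+ 3 /\
  `|\int[P]_w sin (Y w)| <= 25 * expR 2 * s ^+ 3.
Proof.
move=> s0 s1 vs; have s3 : 0 <= s ^+ 3 by rewrite exprn_ge0// ltW.
have e2 := @expR_ge0 R 2; have v0' := v0; have v1' := v1.
have qcos y : `|cos y - 1 + y ^+ 2 / 2| <= q y.
  apply: le_trans (normr_cosB_le3 y) _; rewrite /q ler_wpM2l ?exprn_ge0//.
  by rewrite (@le_trans _ _ 1)//; [lra|rewrite -expR0 ler_expR].
have qsin y : `|sin y - y| <= q y.
  apply: le_trans (normr_sinB_le3 y) _; rewrite /q ler_wpM2l ?exprn_ge0//.
  by rewrite (@le_trans _ _ 1)//; [lra|rewrite -expR0 ler_expR].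
have qexp y : `|expR y - 1 - y - y ^+ 2 / 2| <= q y := normr_expR_taylor2 y.
have qexpN y : `|expR (- y) - 1 + y - y ^+ 2 / 2| <= q y.
  by have := qexp (- y); rewrite /q normrN sqrrN opprK.
have mexp c : measurable_fun setT (fun y : R => expR (c * y)).
  by apply: (measurableT_comp (@measurable_expR R)); exact: measurable_funM.
have EexpY1 : \int[P]_w expR (1 * Y w) = expR (v / 2).
  by rewrite EexpY expr1n mul1r.
have EexpYN1 : \int[P]_w expR (- 1 * Y w) = expR (v / 2).
  by rewrite EexpY sqrrN expr1n mul1r.
split.
  pose h (y : R) := cos y + ((expR (1 * y) + expR (- 1 * y)) / 2 - 2).
  have mh : measurable_fun setT h.
    apply: measurable_funD; first exact: measurable_cos.
    apply: measurable_funB; last exact: measurable_cst.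
    by apply: measurable_funM => //; exact: measurable_funD.
  have hq y : `|h y| <= 2 * q y.
    rewrite /h mul1r mulN1r; move: (qcos y) (qexp y) (qexpN y).
    by rewrite !ler_norml; lra.
  have [hi hle] := mean_le mh hq s0 s1 vs.
  have Eh : \int[P]_w h (Y w) = \int[P]_w cos (Y w) + (expR (v / 2) - 2).
    rewrite /h RintegralD//; last 2 first.
    - exact: integrable_cos.
    - apply: integrableB_EFin; last exact: finite_measure_integrable_cst.
      under [X in integrable _ _ X]eq_fun do rewrite /= mulrC.
      exact: integrableZ_EFin.
    congr (_ + _); rewrite RintegralB//; last 2 first.
    - under [X in integrable _ _ X]eq_fun do rewrite /= mulrC.
      exact: integrableZ_EFin.
    - exact: finite_measure_integrable_cst.
    rewrite Rintegral_cstT RintegralZr// RintegralD// EexpY1 EexpYN1.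
    by field.
  have tv := normr_expR_taylor2 (v / 2).
  have v20' : 0 <= v / 2 by rewrite divr_ge0.
  rewrite (ger0_norm v20') in tv.
  have : `|expR (v / 2) - 1 - v / 2| <= expR 2 * s ^+ 3.
    have e1 : 1 <= expR 2 :> R by rewrite -expR0 ler_expR.
    have ev : expR (v / 2) <= expR 2 by rewrite ler_expR; lra.
    have v2 : v ^+ 2 <= s ^+ 3.
      apply: le_trans (_ : _ <= s ^+ 2 * v) _; first by rewrite expr2 ler_wpM2r.
      rewrite [leRHS]exprSr ler_wpM2l ?exprn_ge0 ?(ltW s0)//.
      by rewrite (le_trans vs)// expr2 ler_piMl// ltW.
    have v3 : (v / 2) ^+ 3 * expR (v / 2) <= v ^+ 2 / 8 * expR 2.
      rewrite ler_pM ?exprn_ge0 ?divr_ge0 ?expR_ge0//.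
      have : v ^+ 3 <= v ^+ 2 by rewrite exprSr ler_piMr// sqr_ge0.
      rewrite expr_div_n; lra.
    have v20 := sqr_ge0 v.
    have p1 := ler_wpM2l e2 v2; have p2 := ler_wpM2l v20 e1.
    move: tv; rewrite ler_norml expr_div_n => /andP[t1 t2].
    by rewrite ler_norml; apply/andP; split; lra.
  move: hle; rewrite Eh !ler_norml => /andP[h1 h2] /andP[g1 g2].
  by apply/andP; split; lra.
pose h (y : R) := sin y - (expR (1 * y) - expR (- 1 * y)) / 2.
have mh : measurable_fun setT h.
  apply: measurable_funB; first exact: measurable_sin.
  by apply: measurable_funM => //; exact: measurable_funB.
have hq y : `|h y| <= 2 * q y.
  rewrite /h mul1r mulN1r; move: (qsin y) (qexp y) (qexpN y).
  by rewrite !ler_norml; lra.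
have [hi hle] := mean_le mh hq s0 s1 vs.
have Eh : \int[P]_w h (Y w) = \int[P]_w sin (Y w).
  rewrite /h RintegralB//; last 2 first.
  - exact: integrable_sin.
  - under [X in integrable _ _ X]eq_fun do rewrite /= mulrC.
    by apply: integrableZ_EFin; exact: integrableB_EFin.
  rewrite RintegralZr//; last exact: integrableB_EFin.
  by rewrite RintegralB// EexpY1 EexpYN1 subrr mul0r subr0.
move: hle; rewrite Eh => hle; apply: le_trans hle _.
by have := mulr_ge0 e2 s3; lra.
Qed.

(** The mean of Y, its variance and the remainders are all read off the moment
    generating function at 1 and -1: cos y + cosh y - 2 and sin y - sinh y
    vanish to order 3 at 0. *)
Lemma gaussian_cf_le :
  `|\int[P]_w cos (Y w) - (1 - v / 2)| <= 25 * expR 2 * (v * Num.sqrt v) /\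
  `|\int[P]_w sin (Y w)| <= 25 * expR 2 * (v * Num.sqrt v).
Proof.
have [v_gt0|] := ltP 0 v.
  have s0 : 0 < Num.sqrt v by rewrite sqrtr_gt0.
  have s1 : Num.sqrt v <= 1 by rewrite -sqrtr1 ler_sqrt.
  have sE : Num.sqrt v ^+ 2 = v by rewrite sqr_sqrtr.
  have := cf_le s0 s1; rewrite sE exprS sE mulrC [_ * v]mulrC; exact.
move=> vle0; have {vle0}vE : v = 0 by apply/le_anti; rewrite vle0.
(* For v = 0 the scale s is arbitrary, and tends to 0. *)
have small (x : R) : (forall s : R, 0 < s -> s <= 1 -> x <= 25 * expR 2 * s ^+ 3) ->
    x <= 0.
  move=> xs; rewrite leNgt; apply/negP => x0.
  have K0 : 0 < 25 * expR 2 :> R by rewrite mulr_gt0// expR_gt0.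
  pose s := Num.min 1 (x / 2 / (25 * expR 2)).
  have s0 : 0 < s by rewrite lt_min ltr01/= !divr_gt0.
  have s1 : s <= 1 by rewrite ge_min lexx.
  have := xs s s0 s1; apply/negP; rewrite -ltNge.
  apply: le_lt_trans (_ : _ <= 25 * expR 2 * s) _.
    by rewrite ler_wpM2l ?(ltW K0)// -[leRHS]expr1 ler_wiXn2l ?(ltW s0).
  apply: le_lt_trans (_ : _ <= 25 * expR 2 * (x / 2 / (25 * expR 2))) _.
    by rewrite ler_wpM2l ?(ltW K0)// ge_min lexx orbT.
  by rewrite mulrC divfK ?gt_eqF//; lra.
have vs s : v <= s ^+ 2 by rewrite vE sqr_ge0.
have -> : v * Num.sqrt v = 0 by rewrite vE mul0r.
by rewrite mulr0; split; apply: small => s s0 s1;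
  have [] := cf_le s0 s1 (vs s).
Qed.

End gaussian_estimates.
End gaussian.

(** * Approximation by trigonometric polynomials *)

Section bernstein.
Context {R : realType}.
Implicit Types (u : R) (f : nat -> R).

Definition bernstein (m a : nat) u : R :=
  (u ^+ a * (1 - u) ^+ (m - a)) *+ 'C(m, a).

Lemma bernstein_ge0 m a u : 0 <= u -> u <= 1 -> 0 <= bernstein m a u.
Proof.
by move=> u0 u1; rewrite mulrn_wge0// mulr_ge0// exprn_ge0// subr_ge0.
Qed.

(** Conditioning a binomial variable on its first trial. *)
Lemma sum_bernsteinS m f u :
  \sum_(a < m.+2) bernstein m.+1 a u * f a =
  (1 - u) * (\sum_(a < m.+1) bernstein m a u * f a) +
  u * (\sum_(a < m.+1) bernstein m a u * f a.+1).
Proof.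
have shift : \sum_(a < m.+1) bernstein m a u * f a = bernstein m 0 u * f 0%N +
    \sum_(a < m.+1) (u ^+ a.+1 * (1 - u) ^+ (m - a.+1)) *+ 'C(m, a.+1) * f a.+1.
  rewrite big_ord_recl; congr (_ + _).
  rewrite [RHS]big_ord_recr/= (bin_small (ltnSn m)) mulr0n mul0r addr0.
  by apply: eq_bigr => i _.
rewrite {}shift mulrDr big_ord_recl -addrA; congr (_ + _).
  by rewrite /bernstein !bin0 !subn0 !expr0 !mulr1n !mul1r exprS; ring.
rewrite !mulr_sumr -big_split/=; apply: eq_bigr => a _.
rewrite /bernstein /bump/= add1n subSS binS.
have := ltn_ord a; rewrite ltnS leq_eqVlt => /predU1P[->|am].
  rewrite subnn (bin_small (ltnSn m)) add0n mulr0n mul0r mulr0 add0r binn.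
  by rewrite !mulr1n exprS; ring.
rewrite -(subnSK am) mulrnDr !exprS -!(mulr_natr (_ * _)).
set p := u ^+ a; set q := (1 - u) ^+ _.
by move: (f _) (_%:R) (_%:R) p q => F c c' p q; ring.
Qed.

Lemma sum_bernstein m u : \sum_(a < m.+1) bernstein m a u = 1.
Proof.
suff: \sum_(a < m.+1) bernstein m a u * (fun=> 1) (a : nat) = 1.
  by under eq_bigr do rewrite mulr1.
elim: m => [|m ih]; last by rewrite (sum_bernsteinS _ (fun=> 1)) ih; ring.
by rewrite big_ord1 /bernstein bin0 subnn !expr0 mulr1n !mulr1.
Qed.

(** The second moment of a binomial variable; the shift c is what the recursion
    on m acts upon. *)
Lemma bernstein_variance m u (c : R) :
  \sum_(a < m.+1) bernstein m a u * (a%:R + c) ^+ 2 =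
  m%:R * u * (1 - u) + (m%:R * u + c) ^+ 2.
Proof.
elim: m c => [|m ih] c.
  rewrite big_ord1 /bernstein bin0 subnn !expr0 mulr1n /= mulr0n; ring.
rewrite (sum_bernsteinS _ (fun a => (a%:R + c) ^+ 2)) ih.
under [X in _ + _ * X]eq_bigr do rewrite -natr1 -addrA.
by rewrite ih -natr1; ring.
Qed.

Lemma bernstein_variance_le m u : 0 <= u -> u <= 1 ->
  \sum_(a < m.+2) bernstein m.+1 a u * (a%:R / m.+1%:R - u) ^+ 2 <=
  m.+1%:R^-1.
Proof.
move=> u0 u1.
rewrite (eq_bigr (fun a : 'I_m.+2 => m.+1%:R ^- 2 *
    (bernstein m.+1 a u * (a%:R + - (m.+1%:R * u)) ^+ 2))); last first.
  move=> a _; have : m.+1%:R != 0 :> R by rewrite pnatr_eq0.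
  by move: (m.+1%:R) (bernstein _ _ _) => n b n0; field.
rewrite -mulr_sumr bernstein_variance subrr expr0n addr0.
rewrite -exprVn expr2 -mulrA ler_piMr ?invr_ge0//.
rewrite -mulrA mulKf ?pnatr_eq0//.
by rewrite mulr_ile1// ?subr_ge0//; lra.
Qed.

End bernstein.

Section trig_poly.
Context {R : realType} {k : nat}.
Implicit Types (x : 'rV[R]_k) (f g : 'rV[R]_k -> R).

(** The phases b make this span closed under multiplication without sines. *)
Inductive trig_poly : ('rV[R]_k -> R) -> Prop :=
| trig_cos (u : 'I_k -> R) (b : R) :
    trig_poly (fun x => cos (\sum_i u i * x ord0 i + b))
| trig_add f g : trig_poly f -> trig_poly g -> trig_poly (fun x => f x + g x)
| trig_scale (c : R) f : trig_poly f -> trig_poly (fun x => c * f x).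

Lemma eq_trig_poly f g : f =1 g -> trig_poly f -> trig_poly g.
Proof. by move=> /funext ->. Qed.

Lemma trig_cst (c : R) : trig_poly (fun=> c).
Proof.
apply: eq_trig_poly (trig_scale c (trig_cos (fun=> 0) 0)) => x /=.
by rewrite big1 ?addr0 ?cos0 ?mulr1// => i _; rewrite mul0r.
Qed.

Lemma trig_mul f g : trig_poly f -> trig_poly g -> trig_poly (fun x => f x * g x).
Proof.
move=> tf tg; elim: tf => {f} [u b|f1 f2 _ ih1 _ ih2|c f _ ih].
- elim: tg => {g} [v c|g1 g2 _ ih1 _ ih2|c g _ ih].
  + apply: eq_trig_poly (trig_scale 2^-1 (trig_add
      (trig_cos (fun i => u i + v i) (b + c))
      (trig_cos (fun i => u i - v i) (b - c)))) => x /=.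
    have -> : \sum_i (u i + v i) * x ord0 i + (b + c) =
        (\sum_i u i * x ord0 i + b) + (\sum_i v i * x ord0 i + c).
      by rewrite addrACA -big_split/=; congr (_ + _); apply: eq_bigr => i _; ring.
    have -> : \sum_i (u i - v i) * x ord0 i + (b - c) =
        (\sum_i u i * x ord0 i + b) - (\sum_i v i * x ord0 i + c).
      rewrite opprD addrACA -sumrB; congr (_ + _).
      by apply: eq_bigr => i _; ring.
    by rewrite cosD cosB; field.
  + by apply: eq_trig_poly (trig_add ih1 ih2) => x /=; ring.
  + by apply: eq_trig_poly (trig_scale c ih) => x /=; ring.
- by apply: eq_trig_poly (trig_add ih1 ih2) => x /=; ring.
- by apply: eq_trig_poly (trig_scale c ih) => x /=; ring.
Qed.

Lemma trig_exp f n : trig_poly f -> trig_poly (fun x => f x ^+ n).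
Proof.
move=> tf; elim: n => [|n ih]; first exact: trig_cst.
by apply: eq_trig_poly (trig_mul tf ih) => x; rewrite exprS.
Qed.

Lemma trig_sum (I : Type) (s : seq I) (F : I -> 'rV[R]_k -> R) :
  (forall i, trig_poly (F i)) -> trig_poly (fun x => \sum_(i <- s) F i x).
Proof.
move=> tF; elim: s => [|i s ih].
  by apply: eq_trig_poly (trig_cst 0) => x; rewrite big_nil.
by apply: eq_trig_poly (trig_add (tF i) ih) => x; rewrite big_cons.
Qed.

Lemma trig_prod (I : Type) (s : seq I) (F : I -> 'rV[R]_k -> R) :
  (forall i, trig_poly (F i)) -> trig_poly (fun x => \prod_(i <- s) F i x).
Proof.
move=> tF; elim: s => [|i s ih].
  by apply: eq_trig_poly (trig_cst 1) => x; rewrite big_nil.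
by apply: eq_trig_poly (trig_mul (tF i) ih) => x; rewrite big_cons.
Qed.

Lemma trig_sin_coord (l : R) i : trig_poly (fun x => sin (x ord0 i / l)).
Proof.
apply: eq_trig_poly (trig_cos (fun j => (j == i)%:R / l) (- (pi / 2))) => x.
rewrite cosBpihalf; congr sin; rewrite (bigD1 i)//= eqxx big1; last first.
  by move=> j /negPf ->; rewrite !mul0r.
by rewrite addr0 mul1r mulrC.
Qed.

End trig_poly.

Section approximation.
Context {R : realType}.

(** The sine separates the points of its monotonicity interval up to the end
    points, where its derivative vanishes: write sin t - sin s as a product. *)
Lemma sin_separation (s t dl : R) : - (pi / 2) <= s -> t <= pi / 2 ->
  0 < dl -> dl <= t - s -> sin (dl / 2) ^+ 2 <= (sin t - sin s) / 2.
Proof.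
move=> s1 t1 dl0 dlts; have pi0 := @pi_gt0 R.
have sint : sin t = sin ((t + s) / 2 + (t - s) / 2) by congr sin; field.
have sins : sin s = sin ((t + s) / 2 - (t - s) / 2) by congr sin; field.
have -> : (sin t - sin s) / 2 = sin ((t - s) / 2) * cos ((t + s) / 2).
  by rewrite sint sins sinD sinB; field.
have sin0 : 0 <= sin (dl / 2) by rewrite ltW// sin_gt0_pi//; lra.
have sina : sin (dl / 2) <= sin ((t - s) / 2).
  rewrite leNgt; apply/negP; rewrite ltr_sin ?in_itv/=; first by lra.
    by lra.
  by lra.
have cosb : sin (dl / 2) <= cos ((t + s) / 2).
  rewrite -cosBpihalf -[leRHS]cos_norm -[leLHS]cosN opprB.
  have h : `|(t + s) / 2| <= pi / 2 - dl / 2 by rewrite ler_norml; lra.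
  have n0 := normr_ge0 ((t + s) / 2).
  rewrite leNgt; apply/negP; rewrite ltr_cos ?in_itv/=; lra.
by rewrite expr2; apply: ler_pM.
Qed.

Lemma sin_separation_norm (s t dl : R) : `|s| <= pi / 2 -> `|t| <= pi / 2 ->
  0 < dl -> dl <= `|t - s| ->
  sin (dl / 2) ^+ 2 <= `|sin t - sin s| / 2.
Proof.
rewrite !ler_norml => /andP[s1 s2] /andP[t1 t2] dl0.
have [st|ts] := leP s t.
  rewrite ger0_norm ?subr_ge0// => h.
  apply: le_trans (sin_separation s1 t2 dl0 h) _.
  by rewrite ler_pM2r// ler_norm.
rewrite distrC ger0_norm ?subr_ge0 ?(ltW ts)// => h.
apply: le_trans (sin_separation t1 s2 dl0 h) _.
by rewrite ler_pM2r// distrC ler_norm.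
Qed.

Lemma sum_prod_ffun_marginal (k n : nat) (w : 'I_k -> 'I_n -> R) (h : 'I_n -> R)
    (i0 : 'I_k) : (forall i, \sum_a w i a = 1) ->
  \sum_(al : {ffun 'I_k -> 'I_n}) (\prod_i w i (al i)) * h (al i0) =
  \sum_a w i0 a * h a.
Proof.
move=> w1.
transitivity (\sum_(al : {ffun 'I_k -> 'I_n})
    \prod_i (w i (al i) * (if i == i0 then h (al i) else 1))).
  apply: eq_bigr => al _; rewrite big_split/=; congr (_ * _).
  by rewrite -big_mkcond/= big_pred1_eq.
rewrite -(bigA_distr_bigA (fun i a => w i a * (if i == i0 then h a else 1))).
rewrite (bigD1 i0)//= eqxx [X in _ * X]big1 ?mulr1// => i /negPf ->.
by under eq_bigr do rewrite mulr1.
Qed.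

Lemma cube_unif_continuous (k : nat) (f : 'rV[R]_k -> R) (M e : R) :
  continuous f -> 0 < e -> exists2 dl : R, 0 < dl &
  forall x y : 'rV[R]_k, (forall i, `|x ord0 i| <= M) ->
    (forall i, `|x ord0 i - y ord0 i| < dl) -> `|f x - f y| <= e.
Proof.
move=> cf e0.
have cK : compact [set x : 'rV[R]_k | forall i, `[- M, M]%classic (x ord0 i)].
  by apply: (@rV_compact _ _ (fun=> `[- M, M]%classic)) => i; exact: segment_compact.
pose Q (dl : R) (x : 'rV[R]_k) := forall y : 'rV[R]_k,
  (forall i, `|x ord0 i - y ord0 i| < dl) -> `|f x - f y| <= e.
have /compact_near_coveringP /(_ R (0^'+) Q _) H := cK.
have /H : forall x : 'rV[R]_k, (forall i, `[- M, M]%classic (x ord0 i)) ->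
    \forall x' \near x & dl \near 0^'+, Q dl x'.
  move=> x _.
  have e2 : 0 < e / 2 by rewrite divr_gt0.
  have /cvgrPdist_lt /(_ _ e2) := cf x.
  move=> /nbhs_ballP[r /= r0 xr].
  have r2 : 0 < r / 2 by rewrite divr_gt0.
  exists (ball x (r / 2), [set dl | dl < r / 2]) => /=.
    by split; [exact: nbhsx_ballx|exact: nbhs_right_lt].
  move=> [x' dl]/= [[_ xx'] dlr] y yx'.
  have fx' : `|f x - f x'| < e / 2.
    apply: xr; split=> // i j; apply: le_ball (xx' i j).
    by move: r0; lra.
  have fy : `|f x - f y| < e / 2.
    apply: xr; split => // i j; rewrite [r]splitr.
    apply: ball_triangle (xx' i j) _; rewrite ord1.
    by rewrite /ball/=; apply: lt_trans dlr; exact: yx'.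
  rewrite -(subrK (f x) (f x')) -addrA (le_trans (ler_normD _ _))// [e]splitr.
  by rewrite lerD// ltW// distrC.
move=> near_dl.
have : \forall dl \near 0^'+, 0 < dl /\
    [set x : 'rV[R]_k | forall i, `[- M, M]%classic (x ord0 i)] `<=` Q dl.
  by apply: filterI; [exact: nbhs_right_gt|exact: near_dl].
move=> /filter_ex[dl [dl0 KQ]]; exists dl => // x y xM; apply: KQ => i /=.
by rewrite in_itv/= -ler_norml.
Qed.

(** A trigonometric polynomial close to f on a large cube and bounded like f
    outside: the Bernstein polynomial of f, in the coordinates given by the
    sine, which maps the cube onto the unit cube and the whole space into it. *)
Lemma trig_poly_approx (k : nat) (f : 'rV[R]_k -> R) (B e : R) :
  continuous f -> (forall x, `|f x| <= B) -> 0 < e ->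
  exists2 g, trig_poly g &
    forall x, `|f x - g x| <= e * (1 + \sum_i x ord0 i ^+ 2).
Proof.
move=> cf fB e0.
have B0 : 0 <= B by apply: le_trans (fB 0).
have pi0 := @pi_gt0 R.
(* Off the cube of half-width M, the bound e * x_i ^ 2 exceeds 2 * B. *)
pose M : R := Num.sqrt (2 * B / e) + 1.
have M0 : 0 < M by rewrite ltr_wpDl// sqrtr_ge0.
have MB : 2 * B <= e * M ^+ 2.
  have Be : 0 <= 2 * B / e by rewrite divr_ge0 ?mulr_ge0 ?(ltW e0).
  rewrite [leRHS]mulrC -ler_pdivrMr// -(sqr_sqrtr Be).
  by rewrite lerXn2r// ?nnegrE ?sqrtr_ge0 ?(ltW M0)// lerDl.
have e20 : 0 < e / 2 by rewrite divr_gt0.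
have [dl dl0 fdl] := cube_unif_continuous M cf e20.
pose l : R := M / (pi / 2).
have l0 : 0 < l by rewrite !divr_gt0.
have lM : l * (pi / 2) = M by rewrite divfK// gt_eqF// divr_gt0.
pose dl' : R := Num.min (dl / l) 1.
have dl'0 : 0 < dl' by rewrite lt_min ltr01 divr_gt0.
have dl'1 : dl' <= 1 by rewrite ge_min lexx orbT.
pose ka : R := sin (dl' / 2) ^+ 2.
have ka0 : 0 < ka.
  by rewrite exprn_gt0// sin_gt0_pi// ; have := pi_ge2 R; lra.
(* ka is the separation in u of a node that is dl away from x, so that
   f x - f (node) is at most e / 2 + C * |u - u (node)| ^ 2. *)
pose C : R := 2 * B / ka ^+ 2.
have C0 : 0 <= C by apply: divr_ge0; [exact: mulr_ge0|exact: sqr_ge0].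
pose m := Num.bound (C * k%:R / (e / 2)).
have mle : C * k%:R * m.+1%:R^-1 <= e / 2.
  rewrite ler_pdivrMr ?ltr0n// -ler_pdivrMl// mulrC.
  have := divr_ge0 (mulr_ge0 C0 (ler0n _ k)) (ltW e20).
  by move=> /archi_boundP/ltW/le_trans; apply; rewrite ler_nat.
pose node (a : nat) : R := l * asin (2 * (a%:R / m.+1%:R) - 1).
pose u (i : 'I_k) (x : 'rV[R]_k) : R := (1 + sin (x ord0 i / l)) / 2.
pose w (x : 'rV[R]_k) (i : 'I_k) (a : 'I_m.+2) : R := bernstein m.+1 a (u i x).
pose y (al : {ffun 'I_k -> 'I_m.+2}) : 'rV[R]_k := \row_i node (al i).
have u01 i x : 0 <= u i x /\ u i x <= 1.
  by rewrite /u; have := sin_le1 (x ord0 i / l); have := sin_geN1 (x ord0 i / l);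
    split; lra.
have w1 x i : \sum_a w x i a = 1 by exact: sum_bernstein.
have w0 x i a : 0 <= w x i a by have [? ?] := u01 i x; exact: bernstein_ge0.
have W1 x : \sum_(al : {ffun 'I_k -> 'I_m.+2}) \prod_i w x i (al i) = 1.
  by rewrite -(bigA_distr_bigA (fun i a => w x i a)) big1.
have W0 x (al : {ffun 'I_k -> 'I_m.+2}) : 0 <= \prod_i w x i (al i).
  exact: prodr_ge0.
exists (fun x => \sum_(al : {ffun 'I_k -> 'I_m.+2}) f (y al) * \prod_i w x i (al i)).
  apply: trig_sum => al; apply: trig_scale; apply: trig_prod => i.
  have tu : trig_poly (u i).
    apply: eq_trig_poly (trig_scale 2^-1 (trig_add (trig_cst 1)
      (trig_sin_coord l i))) => x.
    by rewrite /u mulrC.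
  apply: eq_trig_poly (trig_scale ('C(m.+1, al i)%:R)
    (trig_mul (trig_exp (al i) tu) (trig_exp (m.+1 - al i)
      (trig_add (trig_cst 1) (trig_scale (- 1) tu))))) => x /=.
  by rewrite mulN1r mulr_natl.
move=> x.
have -> : f x - \sum_al f (y al) * \prod_i w x i (al i) =
    \sum_(al : {ffun 'I_k -> 'I_m.+2}) (f x - f (y al)) * \prod_i w x i (al i).
  under [RHS]eq_bigr do rewrite mulrBl.
  by rewrite sumrB -mulr_sumr W1 mulr1.
apply: le_trans (ler_norm_sum _ _ _) _.
under eq_bigr do rewrite normrM (ger0_norm (W0 _ _)).
have S0 : 0 <= \sum_i x ord0 i ^+ 2 by apply: sumr_ge0 => i _; exact: sqr_ge0.
have [/forallP xM|] := boolP [forall i, `|x ord0 i| <= M]; last first.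
  rewrite negb_forall => /existsP[i]; rewrite -ltNge => xM.
  apply: le_trans (_ : _ <= 2 * B) _.
    have -> : 2 * B = \sum_(al : {ffun 'I_k -> 'I_m.+2})
        2 * B * \prod_i w x i (al i) by rewrite -mulr_sumr W1 mulr1.
    apply: ler_sum => al _.
    rewrite ler_wpM2r//; apply: le_trans (ler_normB _ _) _.
    by rewrite mulr_natl mulr2n lerD.
  apply: le_trans MB _; rewrite ler_wpM2l ?(ltW e0)//.
  apply: le_trans (_ : _ <= x ord0 i ^+ 2) _.
    by rewrite -[leRHS]real_normK ?num_real// lerXn2r ?nnegrE ?(ltW M0) ?(ltW xM).
  rewrite (bigD1 i)//= addrCA lerDl addr_ge0// sumr_ge0// => j _.
  exact: sqr_ge0.
have fy al : `|f x - f (y al)| <=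
    e / 2 + \sum_i C * ((al i)%:R / m.+1%:R - u i x) ^+ 2.
  have sum0 i : 0 <= C * ((al i)%:R / m.+1%:R - u i x) ^+ 2.
    by rewrite mulr_ge0// sqr_ge0.
  have [/forallP xy|] := boolP [forall i, `|x ord0 i - y al ord0 i| < dl].
    by rewrite ler_wpDr ?sumr_ge0//; exact: fdl.
  rewrite negb_forall => /existsP[i]; rewrite -leNgt mxE => dlx.
  apply: le_trans (_ : _ <= C * ((al i)%:R / m.+1%:R - u i x) ^+ 2) _; last first.
    by rewrite (bigD1 i)//= addrCA lerDl addr_ge0 ?(ltW e20) ?sumr_ge0.
  apply: le_trans (_ : _ <= 2 * B) _.
    by rewrite (le_trans (ler_normB _ _))// mulr_natl mulr2n lerD.
  have -> : 2 * B = C * ka ^+ 2 by rewrite /C divfK// gt_eqF// exprn_gt0.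
  rewrite ler_wpM2l//.
  pose c : R := 2 * ((al i)%:R / m.+1%:R) - 1.
  have {}dlx : dl <= `|x ord0 i - l * asin c| := dlx.
  have c1 : -1 <= c <= 1.
    have : 0 <= (al i)%:R / m.+1%:R :> R by rewrite divr_ge0.
    have : (al i)%:R / m.+1%:R <= 1 :> R.
      by rewrite ler_pdivrMr ?ltr0n// mul1r ler_nat -ltnS ltn_ord.
    by rewrite /c; move: (_ / m.+1%:R) => r r1 r0; apply/andP; split; lra.
  have sep : ka <= `|sin (x ord0 i / l) - sin (asin c)| / 2.
    apply: sin_separation_norm => //.
    - by rewrite ler_norml asin_geNpi2// asin_lepi2.
    - by rewrite normrM normfV (gtr0_norm l0) ler_pdivrMr// mulrC lM.
    - rewrite ge_min; apply/orP; left; rewrite ler_pdivrMr//.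
      rewrite -{2}(gtr0_norm l0) -normrM mulrBl divfK ?gt_eqF//.
      by rewrite [asin c * l]mulrC.
  rewrite asinK ?in_itv// in sep.
  rewrite -[leRHS]real_normK ?num_real// lerXn2r ?nnegrE ?(ltW ka0)//.
  apply: le_trans sep _; rewrite le_eqVlt; apply/orP; left; apply/eqP.
  rewrite (_ : _ - u i x = - ((sin (x ord0 i / l) - c) / 2)).
    by rewrite normrN normrM normfV normr_nat.
  by rewrite /u /c; move: (_ / m.+1%:R) => r; field.
apply: le_trans (_ : _ <= \sum_(al : {ffun 'I_k -> 'I_m.+2})
    (e / 2 + \sum_i C * ((al i)%:R / m.+1%:R - u i x) ^+ 2) * \prod_i w x i (al i)) _.
  by apply: ler_sum => al _; rewrite ler_wpM2r.
under eq_bigr do rewrite mulrDl.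
rewrite big_split/= -mulr_sumr W1 mulr1.
under eq_bigr do rewrite mulr_suml.
rewrite exchange_big/=.
apply: le_trans (_ : _ <= e / 2 + \sum_(i < k) C * m.+1%:R^-1) _.
  rewrite lerD2l; apply: ler_sum => i _.
  under eq_bigr do rewrite -mulrA [_ ^+ 2 * _]mulrC.
  rewrite -mulr_sumr ler_wpM2l//.
  rewrite (sum_prod_ffun_marginal (fun a => (a%:R / m.+1%:R - u i x) ^+ 2) i (w1 x)).
  by have [? ?] := u01 i x; exact: bernstein_variance_le.
rewrite sumr_const card_ord -[_ *+ k]mulr_natr.
apply: le_trans (_ : _ <= e) _.
  by rewrite [leRHS]splitr lerD2l mulrAC.
by rewrite ler_peMr ?(ltW e0)// lerDl.
Qed.

End approximation.

(** * Sums of independent variables and the Lindeberg condition *)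

Section replacement.
Context {R : realType} {d : measure_display} {T : measurableType d}.
Variable P : probability T R.

Lemma indep2Zr (U V : T -> R) (c : R) : indep2 P U V ->
  indep2 P U (fun w => c * V w).
Proof.
move=> iUV A B mA mB.
rewrite (_ : (fun w => c * V w) @^-1` B = V @^-1` (( *%R c) @^-1` B))//.
by apply: iUV => //; rewrite -[_ @^-1` _]setTI; exact: mulrl_measurable.
Qed.

Section summands.
Variable X : nat -> {RV P >-> R}.
Hypothesis Xindep : independent_family P [set j | (1 <= j)%N] X.
Hypothesis Xcentered : forall j, (1 <= j)%N -> 'E_P[X j]%E = 0%E.
Hypothesis Xsquare : forall j, (1 <= j)%N -> (X j : T -> R) \in Lfun P 2%:E.

Let mX j : measurable_fun setT (X j). Proof. exact: measurable_funPT. Qed.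

Let iX2 j : (1 <= j)%N -> P.-integrable setT (EFin \o (fun w => X j w ^+ 2)).
Proof. by move=> j1; exact/Lfun2_integrable_sqr/Xsquare. Qed.

Let iX j : (1 <= j)%N -> P.-integrable setT (EFin \o X j).
Proof.
move=> j1; apply/Lfun1_integrable; apply: Lfun_subset12; last exact: Xsquare.
by rewrite fin_num_measure.
Qed.

Let EX j : (1 <= j)%N -> \int[P]_w X j w = 0.
Proof. by move=> j1; have := Xcentered j1; rewrite unlock /Rintegral => ->. Qed.

Lemma sum_varE n : sum_var P X n = \sum_(1 <= k < n.+1) \int[P]_w (X k w ^+ 2).
Proof. by apply: eq_bigr => k _; rewrite unlock. Qed.

Lemma sum_varS n :
  sum_var P X n.+1 = sum_var P X n + \int[P]_w (X n.+1 w ^+ 2).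
Proof. by rewrite !sum_varE big_nat_recr. Qed.

Lemma sum_var0 : sum_var P X 0 = 0.
Proof. by rewrite sum_varE big_geq. Qed.

Lemma sum_var_mono m n : (m <= n)%N -> sum_var P X m <= sum_var P X n.
Proof.
move=> mn; rewrite -(subnKC mn); elim: (n - m)%N => [|k ih]; first by rewrite addn0.
rewrite addnS sum_varS (le_trans ih)// lerDl; apply: Rintegral_ge0 => w _.
exact: sqr_ge0.
Qed.

Lemma sum_var_ge0 n : 0 <= sum_var P X n.
Proof. by rewrite -sum_var0 sum_var_mono. Qed.

Lemma sum_sd_sqr n : sum_sd P X n ^+ 2 = sum_var P X n.
Proof. by rewrite sqr_sqrtr// sum_var_ge0. Qed.

Lemma measurable_partial_sum n : measurable_fun setT (partial_sum X n).
Proof. by apply: measurable_sum => j; exact: mX. Qed.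

Lemma weighted_sum_indep2 (c : nat -> R) n :
  indep2 P (fun w => \sum_(1 <= j < n.+1) c j * X j w) (X n.+1).
Proof.
apply: (indep2_sum (D := [set j | (1 <= j)%N])) => //.
- by move=> j; rewrite mem_index_iota => /andP[].
- by rewrite mem_index_iota ltnn andbF.
Qed.

Lemma partial_sum_sqr n :
  P.-integrable setT (EFin \o (fun w => partial_sum X n w ^+ 2)) /\
  \int[P]_w (partial_sum X n w ^+ 2) = sum_var P X n.
Proof.
suff [] : P.-integrable setT (EFin \o partial_sum X n) /\
  (P.-integrable setT (EFin \o (fun w => partial_sum X n w ^+ 2)) /\
   \int[P]_w (partial_sum X n w ^+ 2) = sum_var P X n) by [].
elim: n => [|n [iS [iS2 ES2]]].
  have S0 w : partial_sum X 0 w = 0 by rewrite /partial_sum big_geq.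
  have i0 : P.-integrable setT (EFin \o (fun=> 0 : R)).
    exact: finite_measure_integrable_cst.
  split; first by under [X in integrable _ _ X]eq_fun do rewrite /= S0.
  split; first by under [X in integrable _ _ X]eq_fun do rewrite /= S0 expr0n.
  under eq_Rintegral do rewrite S0 expr0n/=.
  by rewrite Rintegral_cstT sum_var0.
have SE w : partial_sum X n.+1 w = partial_sum X n w + X n.+1 w.
  by rewrite /partial_sum big_nat_recr.
have iSX : indep2 P (partial_sum X n) (X n.+1).
  have := weighted_sum_indep2 (fun=> 1) n.
  congr (indep2 P _ _); apply/funext => w.
  by apply: eq_bigr => j _; rewrite mul1r.
have mid : measurable_fun setT (id : R -> R) by exact: measurable_id.
have [iSXm ESX] := indep2_mul (measurable_partial_sum n) (mX n.+1) mid mid iSX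
  iS (iX (ltn0Sn n)).
have SE2 w : partial_sum X n.+1 w ^+ 2 =
    (partial_sum X n w ^+ 2 + X n.+1 w ^+ 2) + 2 * (partial_sum X n w * X n.+1 w).
  by rewrite SE; ring.
have i1 : P.-integrable setT
    (EFin \o (fun w => partial_sum X n w ^+ 2 + X n.+1 w ^+ 2)).
  by apply: integrableD_EFin => //; exact: iX2.
have i2 : P.-integrable setT
    (EFin \o (fun w => 2 * (partial_sum X n w * X n.+1 w))).
  exact: integrableZ_EFin.
split.
  under [X in integrable _ _ X]eq_fun do rewrite /= SE.
  by apply: integrableD_EFin => //; exact: iX.
split.
  under [X in integrable _ _ X]eq_fun do rewrite /= SE2.
  exact: integrableD_EFin.
under eq_Rintegral do rewrite SE2.
rewrite RintegralD// RintegralD//; last exact: iX2.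
by rewrite RintegralZl// ESX (EX (ltn0Sn n)) !mulr0 addr0 ES2 sum_varS.
Qed.

Definition lindeberg_sum (e : R) (n : nat) : R :=
  (sum_var P X n)^-1 * \sum_(1 <= j < n.+1)
     \int[P]_(w in [set w | e * sum_sd P X n <= `|X j w|]) (X j w ^+ 2).

Let measurable_tail (c : R) j : measurable [set w | c <= `|X j w|].
Proof.
rewrite (_ : [set _ | _] = (Num.norm \o X j) @^-1` `[c, +oo[%classic).
  by rewrite -[_ @^-1` _]setTI; apply: measurableT_comp.
by apply/seteqP; split => w /=; rewrite in_itv/= andbT.
Qed.

Let iX2tail (c : R) j : (1 <= j)%N -> P.-integrable setT
  (EFin \o ((fun w => X j w ^+ 2) \_ [set w | c <= `|X j w|])).
Proof.
move=> j1; rewrite -restrict_EFin; apply/integrable_restrict => //.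
rewrite setTI; apply: integrableS (iX2 j1) => //.
Qed.

(** Taylor's formula to second order under the mean: the first order term vanishes
    because X is centered, and the remainder is cubic where |X| < e / th * s and
    at most quadratic elsewhere. *)
Lemma summand_cf_le (c th s e : R) j : (1 <= j)%N -> 0 < e -> 0 < s -> 0 < th ->
  `|c| <= th / s ->
  let err := e * (th ^+ 2 / s ^+ 2 * \int[P]_w (X j w ^+ 2)) +
    th ^+ 2 / s ^+ 2 * \int[P]_(w in [set w | e / th * s <= `|X j w|]) (X j w ^+ 2) in
  `|\int[P]_w cos (c * X j w) - (1 - c ^+ 2 * (\int[P]_w (X j w ^+ 2)) / 2)| <= err
  /\ `|\int[P]_w sin (c * X j w)| <= err.
Proof.
move=> j1 e0 s0 th0 cth err.
pose A := [set w | e / th * s <= `|X j w|].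
pose g w : R := e * (th ^+ 2 / s ^+ 2 * X j w ^+ 2) +
  th ^+ 2 / s ^+ 2 * ((fun w => X j w ^+ 2) \_ A) w.
have i1 : P.-integrable setT (EFin \o (fun w => e * (th ^+ 2 / s ^+ 2 * X j w ^+ 2))).
  by do 2 apply: integrableZ_EFin; exact: iX2.
have i2 : P.-integrable setT
    (EFin \o (fun w => th ^+ 2 / s ^+ 2 * ((fun w => X j w ^+ 2) \_ A) w)).
  by apply: integrableZ_EFin; exact: iX2tail.
have ig : P.-integrable setT (EFin \o g) by exact: integrableD_EFin.
have Eg : \int[P]_w g w = err.
  rewrite /g RintegralD// RintegralZl//; last first.
    by apply: integrableZ_EFin; exact: iX2.
  rewrite RintegralZl//; last exact: iX2.
  by rewrite RintegralZl -?Rintegral_mkcond//; exact: iX2tail.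
have c2 : c ^+ 2 <= th ^+ 2 / s ^+ 2.
  rewrite -expr_div_n -[leLHS]real_normK ?num_real// lerXn2r ?nnegrE//.
  by rewrite divr_ge0 ?ltW.
have lg w : lindeberg_weight e (c * X j w) <= g w.
  rewrite /lindeberg_weight /g exprMn; apply: lerD.
    by rewrite ler_wpM2l ?(ltW e0)// ler_wpM2r ?sqr_ge0.
  have X20 := sqr_ge0 (X j w).
  case: ifPn => [h|_]; last first.
    by rewrite mulr_ge0 ?divr_ge0 ?sqr_ge0// patchE; case: ifP.
  rewrite patchE ifT; first by rewrite ler_wpM2r.
  rewrite inE /A/=; rewrite mulrAC ler_pdivrMr//.
  move: h; rewrite normrM => h.
  have := le_trans h (ler_wpM2r (normr_ge0 (X j w)) cth).
  by rewrite mulrAC ler_pdivlMr// [X in _ <= X]mulrC.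
have mcX : measurable_fun setT (fun w => c * X j w) by exact: measurable_funM.
have icos : P.-integrable setT
    (EFin \o (fun w => cos (c * X j w) - 1 + (c * X j w) ^+ 2 / 2)).
  apply: integrableD_EFin.
    apply: integrableB_EFin; first exact: integrable_cos.
    exact: finite_measure_integrable_cst.
  under [X in integrable _ _ X]eq_fun do rewrite /= exprMn mulrC mulrA.
  by apply: integrableZ_EFin; exact: iX2.
have isin : P.-integrable setT (EFin \o (fun w => sin (c * X j w) - c * X j w)).
  apply: integrableB_EFin; first exact: integrable_sin.
  by apply: integrableZ_EFin; exact: iX.
split.
  have -> : \int[P]_w cos (c * X j w) - (1 - c ^+ 2 * (\int[P]_w (X j w ^+ 2)) / 2) =
      \int[P]_w (cos (c * X j w) - 1 + (c * X j w) ^+ 2 / 2).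
    rewrite RintegralD//; last 2 first.
    - apply: integrableB_EFin; first exact: integrable_cos.
      exact: finite_measure_integrable_cst.
    - under [X in integrable _ _ X]eq_fun do rewrite /= exprMn mulrC mulrA.
      by apply: integrableZ_EFin; exact: iX2.
    rewrite RintegralB//; last 2 first.
    - exact: integrable_cos.
    - exact: finite_measure_integrable_cst.
    rewrite Rintegral_cstT.
    under [X in _ = _ + X]eq_Rintegral do rewrite exprMn mulrC mulrA.
    by rewrite RintegralZl ?iX2//; field.
  rewrite -Eg; apply: Rintegral_dominated => // w.
  by apply: le_trans (lg w); exact: normr_cosB_weight.
have -> : \int[P]_w sin (c * X j w) = \int[P]_w (sin (c * X j w) - c * X j w).
  rewrite RintegralB//; last 2 first.
  - exact: integrable_sin.
  - by apply: integrableZ_EFin; exact: iX.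
  by rewrite RintegralZl ?iX// EX// mulr0 subr0.
rewrite -Eg; apply: Rintegral_dominated => // w.
by apply: le_trans (lg w); exact: normr_sinB_weight.
Qed.

(** Where |X_k| < e * s_n the square contributes at most e ^ 2 * s_n ^ 2, and the
    rest is a single term of the Lindeberg sum. *)
Lemma variance_le_lindeberg (e : R) n k : (1 <= k <= n)%N -> 0 < sum_sd P X n ->
  0 < e ->
  (\int[P]_w (X k w ^+ 2)) / sum_var P X n <= e ^+ 2 + lindeberg_sum e n.
Proof.
move=> /andP[k1 kn] s0 e0; rewrite -sum_sd_sqr.
set s := sum_sd P X n in s0 *.
have s20 : 0 < s ^+ 2 by rewrite exprn_gt0.
set A := [set w | e * s <= `|X k w|].
have tail : \int[P]_(w in A) (X k w ^+ 2) / s ^+ 2 <= lindeberg_sum e n.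
  rewrite /lindeberg_sum -sum_sd_sqr -/s [leRHS]mulrC ler_wpM2r ?invr_ge0 ?(ltW s20)//.
  rewrite (big_cat_nat (n := k))//=; last by rewrite ltnW.
  rewrite (big_ltn (m := k))//=.
  rewrite addrCA lerDl addr_ge0// sumr_ge0// => j _;
    by apply: Rintegral_ge0 => w _; exact: sqr_ge0.
apply: le_trans (_ : _ <= e ^+ 2 + \int[P]_(w in A) (X k w ^+ 2) / s ^+ 2) _; last first.
  by rewrite lerD2l.
rewrite ler_pdivrMr// mulrDl divfK ?gt_eqF// -exprMn.
rewrite [X in _ + X]Rintegral_mkcond.
rewrite -{1}(Rintegral_cstT P ((e * s) ^+ 2)) -RintegralD//; last 2 first.
- exact: finite_measure_integrable_cst.
- exact: iX2tail.
apply: le_Rintegral => //.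
- exact: iX2.
- apply: integrableD_EFin; last exact: iX2tail.
  exact: finite_measure_integrable_cst.
move=> w _; rewrite patchE; case: ifPn => [_|].
  by rewrite lerDr sqr_ge0.
rewrite notin_setE /A/= => /negP; rewrite -ltNge addr0 => h.
rewrite -[leLHS]real_normK ?num_real// lerXn2r ?nnegrE ?(ltW h)//.
by rewrite mulr_ge0 ?ltW.
Qed.

End summands.
End replacement.

(** * Replacement by the increments of a Wiener process *)

Lemma sum_nat_prefix {R : pzRingType} (F : nat -> R) q n : (q <= n)%N ->
  \sum_(0 <= j < q) F j = \sum_(0 <= j < n) (j < q)%:R * F j.
Proof.
move=> qn; rewrite (big_cat_nat (n := q) (p := n))//= [X in _ = _ + X]big_nat_cond.
rewrite [X in _ = _ + X]big1; last first.
  by move=> j /andP[/andP[qj _] _]; rewrite ltnNge qj mul0r.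
by rewrite addr0; apply: eq_big_nat => j /andP[_ ->]; rewrite mul1r.
Qed.

Section wiener.
Context {R : realType} {d : measure_display} {T : measurableType d}.
Variables (P : probability T R) (W : R -> T -> R).
Hypothesis Ww : standard_wiener P W.

Lemma wiener_measurable t : 0 <= t -> t <= 1 -> measurable_fun setT (W t).
Proof. by move=> t0 t1; case: Ww => + _ _ _ _; apply; rewrite in_itv/= t0. Qed.

Lemma wiener_increment_measurable s t : 0 <= s -> s <= t -> t <= 1 ->
  measurable_fun setT (fun w => W t w - W s w).
Proof.
move=> s0 st t1; apply: measurable_funB; apply: wiener_measurable => //.
  exact: le_trans st.
exact: le_trans t1.
Qed.

Lemma wiener_increment s t : 0 <= s -> s <= t -> t <= 1 ->
  gaussian P (fun w => W t w - W s w) (t - s).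
Proof.
move=> s0 st t1; move: (st); rewrite le_eqVlt => /predU1P[<-|slt].
  by rewrite subrr; apply: gaussian_cst0 => w; rewrite subrr.
apply: normal_gaussian; first by rewrite subr_gt0.
  exact: wiener_increment_measurable.
by case: Ww => _ _ _ + _; apply.
Qed.

Lemma wiener_increments_indep2 (n : nat) (t c : nat -> R) : 0 <= t 0%N -> t n <= 1 ->
  (forall i, (i < n)%N -> t i <= t i.+1) ->
  forall k, (k < n)%N ->
  indep2 P (fun w => \sum_(0 <= j < k) c j * (W (t j.+1) w - W (t j) w))
           (fun w => W (t k.+1) w - W (t k) w).
Proof.
move=> t0 tn tmono k kn.
have tle i j : (i <= j <= n)%N -> t i <= t j.
  move=> /andP[ij]; rewrite -(subnKC ij).
  elim: (j - i)%N => [|m ih]; first by rewrite addn0.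
  rewrite addnS => h; rewrite (le_trans (ih (ltnW h)))//.
  exact: tmono.
have t0i i : (i <= n)%N -> 0 <= t i.
  by move=> ni; rewrite (le_trans t0)// tle.
have ti1 i : (i <= n)%N -> t i <= 1.
  by move=> ni; rewrite (le_trans _ tn)// tle// ni leqnn.
pose D (i : 'I_n) (w : T) := W (t i.+1) w - W (t i) w.
have iD : independent_family P [set: 'I_n] D.
  by case: Ww => _ _ /(_ n t t0 tn tmono).
have mD (i : 'I_n) : measurable_fun setT (D i).
  by apply: wiener_increment_measurable; [exact/t0i/ltnW|exact: tmono|exact: ti1].
pose s := [seq i : 'I_n <- index_enum 'I_n | (i < k)%N].
have := @indep2_sum R d T P _ _ D (fun i _ => mD i) iD s (fun i => c i) (Ordinal kn).
rewrite mem_filter/= ltnn/= => /(_ (fun _ _ => I) I isT).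
congr (indep2 P _ _); apply/funext => w.
rewrite big_filter big_mkord.
by rewrite (big_ord_widen n (fun j => c j * (W (t j.+1) w - W (t j) w)) (ltnW kn)).
Qed.

Lemma wiener_telescope (t : nat -> R) (m n : nat) w : (m <= n)%N ->
  W (t m) w - W (t 0%N) w =
  \sum_(0 <= j < n) (j < m)%:R * (W (t j.+1) w - W (t j) w).
Proof.
by move=> mn; rewrite -(telescope_sumr (fun j => W (t j) w))// (sum_nat_prefix _ mn).
Qed.

End wiener.

Section swap_wiener.
Context {R : realType} {d d' : measure_display}.
Context {T : measurableType d} {T' : measurableType d'}.
Variables (P : probability T R) (P' : probability T' R).
Variables (X : nat -> {RV P >-> R}) (W : R -> T' -> R).
Hypothesis Xindep : independent_family P [set j | (1 <= j)%N] X.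
Hypothesis Xcentered : forall j, (1 <= j)%N -> 'E_P[X j]%E = 0%E.
Hypothesis Xsquare : forall j, (1 <= j)%N -> (X j : T -> R) \in Lfun P 2%:E.
Hypothesis Ww : standard_wiener P' W.

(** Along this clock, the increments of W have the variances of the X k / s_n. *)
Definition var_clock (n k : nat) : R := sum_var P X k / sum_var P X n.

Lemma var_clock_itv n m : (m <= n)%N -> 0 <= var_clock n m /\ var_clock n m <= 1.
Proof.
move=> mn; rewrite /var_clock; split.
  by rewrite divr_ge0 ?sum_var_ge0.
have [v0|] := ltP 0 (sum_var P X n).
  by rewrite ler_pdivrMr// mul1r sum_var_mono.
move=> v0; have -> : sum_var P X n = 0 by apply/le_anti; rewrite v0 sum_var_ge0.
by rewrite invr0 mulr0.
Qed.

Section row.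
Variables (n : nat) (th e r : R) (c : nat -> R).
Hypotheses (s0 : 0 < sum_sd P X n) (th0 : 0 < th) (e0 : 0 < e).
Hypothesis cth : forall k, `|c k| <= th.
Hypothesis rn : forall k, (1 <= k <= n)%N ->
  (\int[P]_w (X k w ^+ 2)) / sum_var P X n <= r ^+ 2.
Hypotheses (r0 : 0 <= r) (thr : th * r <= 1).

Let v0 : 0 < sum_var P X n.
Proof. by rewrite -sum_sd_sqr exprn_gt0. Qed.

Let t := var_clock n.

Let t0 : t 0%N = 0. Proof. by rewrite /t /var_clock sum_var0 mul0r. Qed.

Let tn : t n = 1. Proof. by rewrite /t /var_clock divff// gt_eqF. Qed.

Let tS k : t k.+1 - t k = (\int[P]_w (X k.+1 w ^+ 2)) / sum_var P X n.
Proof. by rewrite /t /var_clock sum_varS mulrDl addrC addKr. Qed.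

Let dt0 k : 0 <= t k.+1 - t k.
Proof.
rewrite tS divr_ge0 ?(ltW v0)//; apply: Rintegral_ge0 => w _; exact: sqr_ge0.
Qed.

Let tmono k : t k <= t k.+1. Proof. by rewrite -subr_ge0. Qed.

Let xi k w := c k / sum_sd P X n * X k.+1 w.
Let eta k w := c k * (W (t k.+1) w - W (t k) w).

Let tail k : R := th ^+ 2 / sum_sd P X n ^+ 2 *
  \int[P]_(w in [set w | e / th * sum_sd P X n <= `|X k w|]) (X k w ^+ 2).

Let K : R := 25 * expR 2.

Let one_term k : (k < n)%N -> cf_dist P P' (xi k) (eta k) <=
  2 * e * th ^+ 2 * (t k.+1 - t k) + 2 * tail k.+1 +
  2 * K * th ^+ 3 * r * (t k.+1 - t k).
Proof.
move=> kn; set dt := t k.+1 - t k.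
have cs : `|c k / sum_sd P X n| <= th / sum_sd P X n.
  by rewrite normrM normfV (gtr0_norm s0) ler_pM2r ?invr_gt0.
have [hc hs] := summand_cf_le Xcentered Xsquare (ltn0Sn k) e0 s0 th0 cs.
have dtE : dt = (\int[P]_w (X k.+1 w ^+ 2)) / sum_sd P X n ^+ 2.
  by rewrite /dt tS -sum_sd_sqr.
have E1 : e * (th ^+ 2 / sum_sd P X n ^+ 2 * \int[P]_w (X k.+1 w ^+ 2)) = e * th ^+ 2 * dt.
  by rewrite dtE; ring.
rewrite E1 -/(tail k.+1) in hc hs.
have E2 : (c k / sum_sd P X n) ^+ 2 * (\int[P]_w (X k.+1 w ^+ 2)) / 2 = c k ^+ 2 * dt / 2.
  by rewrite dtE expr_div_n; ring.
rewrite E2 in hc.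
have [tk0 _] := var_clock_itv (ltnW kn); have [_ tk1] := var_clock_itv kn.
have G := gaussianZ (c k) (wiener_increment Ww tk0 (tmono k) tk1).
rewrite -/dt in G.
have dtr : dt <= r ^+ 2 by rewrite /dt tS; apply: rn; rewrite kn.
have dt_ge0 : 0 <= dt by exact: dt0.
have c2 : c k ^+ 2 <= th ^+ 2.
  by rewrite -[leLHS]real_normK ?num_real// lerXn2r ?nnegrE ?(ltW th0).
have v1 : c k ^+ 2 * dt <= 1.
  apply: le_trans (_ : _ <= th ^+ 2 * r ^+ 2) _.
    by apply: ler_pM; rewrite ?sqr_ge0.
  by rewrite -exprMn exprn_ile1// mulr_ge0// ltW.
have v0' : 0 <= c k ^+ 2 * dt by rewrite mulr_ge0 ?sqr_ge0.
have [gc gs] := gaussian_cf_le G v0' v1.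
have gK : 25 * expR 2 * (c k ^+ 2 * dt * Num.sqrt (c k ^+ 2 * dt)) <=
    K * th ^+ 3 * r * dt.
  have -> : K * th ^+ 3 * r * dt = K * (th ^+ 2 * dt * (th * r)) by ring.
  rewrite /K ler_wpM2l ?mulr_ge0 ?expR_ge0//.
  apply: ler_pM; rewrite ?sqrtr_ge0//; first by rewrite ler_wpM2r.
  have thr0 : 0 <= th * r by rewrite mulr_ge0 ?(ltW th0).
  rewrite -[leRHS]ger0_norm// -sqrtr_sqr ler_wsqrtr// exprMn.
  by apply: ler_pM; rewrite ?sqr_ge0.
have gc' := le_trans gc gK; have gs' := le_trans gs gK.
move: hc hs gc' gs'; rewrite /cf_dist -/(xi k).
set Cx := \int[P]_w cos _; set Sx := \int[P]_w sin _.
set Cy := \int[P']_w cos _; set Sy := \int[P']_w sin _.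
move=> hc hs hcy hsy.
have := le_trans (ler_distD (1 - c k ^+ 2 * dt / 2) Cx Cy) (lerD hc _).
rewrite distrC in hcy; move=> /(_ _ hcy) h1.
have := le_trans (ler_normB Sx Sy) (lerD hs hsy) => h2.
by lra.
Qed.

(** The costs of the n replacements add up, and the increments of the clock add
    up to 1. Here r bounds the standard deviations of the summands, so that the
    cubic errors stay below r times the variances. *)
Lemma row_cf_le b :
  `|\int[P]_w cos (\sum_(0 <= k < n) c k / sum_sd P X n * X k.+1 w + b) -
    \int[P']_w cos (\sum_(0 <= k < n) c k * (W (t k.+1) w - W (t k) w) + b)|
  <= 2 * e * th ^+ 2 + 2 * th ^+ 2 * lindeberg_sum X (e / th) n +
     2 * K * th ^+ 3 * r.
Proof.
have mW k : (k < n)%N -> measurable_fun setT (fun w => W (t k.+1) w - W (t k) w).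
  move=> kn; have [? _] := var_clock_itv (ltnW kn); have [_ ?] := var_clock_itv kn.
  by apply: (wiener_increment_measurable Ww).
have h := @swap_sum R _ _ T T' P P' xi eta n _ _ _ _ b.
apply: le_trans (h _ _ _ _) _.
- by move=> k _; apply: measurable_funM.
- by move=> k kn; apply: measurable_funM => //; exact: mW.
- move=> k kn; apply: indep2Zr.
  have := weighted_sum_indep2 Xindep (fun j => c j.-1 / sum_sd P X n) k.
  by congr (indep2 P _ _); apply/funext => w; rewrite big_add1.
- move=> k kn; apply: indep2Zr.
  by apply: (wiener_increments_indep2 Ww (n := n)) => //; rewrite ?t0 ?tn.
apply: le_trans (_ : _ <= \sum_(0 <= k < n)
  (2 * e * th ^+ 2 * (t k.+1 - t k) + 2 * tail k.+1 +
  2 * K * th ^+ 3 * r * (t k.+1 - t k))) _.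
  by apply: ler_sum_nat => k /andP[_ kn]; exact: one_term.
rewrite !big_split/= -!mulr_sumr telescope_sumr// t0 tn subr0 !mulr1.
rewrite lerD2r lerD2l /lindeberg_sum big_add1/= -sum_sd_sqr.
by rewrite le_eqVlt; apply/orP; left; apply/eqP; ring.
Qed.

End row.
End swap_wiener.

(** * Functions of random vectors *)

Section random_vectors.
Context {R : realType} {d : measure_display} {T : measurableType d}.
Variables (P : probability T R) (k : nat) (Z : T -> 'rV[R]_k).
Hypothesis mZ : forall i, measurable_fun setT (fun w => Z w ord0 i).

Lemma trig_poly_measurable g : trig_poly g -> measurable_fun setT (g \o Z).
Proof.
elim => [u b|f h _ mf _ mh|c f _ mf].
- apply: measurable_cos_comp; apply: measurable_funD => //.
  by apply: measurable_sum => i; apply: measurable_funM.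
- exact: measurable_funD.
- exact: measurable_funM.
Qed.

Lemma trig_poly_bounded (g : 'rV[R]_k -> R) : trig_poly g ->
  exists C, forall x, `|g x| <= C.
Proof.
elim => [u b|f h _ [C fC] _ [D hD]|c f _ [C fC]].
- by exists 1 => x; exact: cos_max.
- by exists (C + D) => x; rewrite (le_trans (ler_normD _ _))// lerD.
- by exists (`|c| * C) => x; rewrite normrM ler_wpM2l.
Qed.

Lemma trig_poly_integrable g : trig_poly g ->
  P.-integrable setT (EFin \o (fun w => g (Z w))).
Proof.
move=> tg; have [C gC] := trig_poly_bounded tg.
by apply: (@integrable_le_bounded _ _ _ P _ C) => //; exact: trig_poly_measurable.
Qed.

(** The approximations turn f o Z into a pointwise limit of functions built from
    the coordinates of Z. *)
Lemma continuous_vector_measurable (f : 'rV[R]_k -> R) (B : R) :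
  continuous f -> (forall x, `|f x| <= B) -> measurable_fun setT (f \o Z).
Proof.
move=> cf fB.
have [g gP] : {g : nat -> 'rV[R]_k -> R & forall n, trig_poly (g n) /\
    forall x, `|f x - g n x| <= n.+1%:R^-1 * (1 + \sum_i x ord0 i ^+ 2)}.
  apply: (@choice _ _ (fun n g => trig_poly g /\
    forall x, `|f x - g x| <= n.+1%:R^-1 * (1 + \sum_i x ord0 i ^+ 2))) => n.
  have [|g tg gf] := @trig_poly_approx R k f B n.+1%:R^-1 cf fB.
    by rewrite invr_gt0 ltr0n.
  by exists g.
apply: (measurable_fun_cvg (h := fun n => g n \o Z)).
  by move=> n; apply: trig_poly_measurable; exact: (gP n).1.
move=> w _ /=; apply/cvgrPdist_le => e e0.
set S := 1 + \sum_i Z w ord0 i ^+ 2.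
have S0 : 0 < S by rewrite ltr_wpDr// sumr_ge0// => i _; exact: sqr_ge0.
near=> n; apply: le_trans ((gP n).2 (Z w)) _; rewrite -/S.
rewrite -ler_pdivlMr//.
by apply/ltW; near: n; exact: (near_infty_natSinv_lt (PosNum (divr_gt0 e0 S0))).
Unshelve. all: by end_near. Qed.

(** Bounded second moments play the role of tightness. *)
Lemma trig_poly_approx_mean (f g : 'rV[R]_k -> R) (B e c : R) :
  continuous f -> (forall x, `|f x| <= B) -> trig_poly g -> 0 <= e ->
  (forall x, `|f x - g x| <= e * (1 + \sum_i x ord0 i ^+ 2)) ->
  (forall i, P.-integrable setT (EFin \o (fun w => Z w ord0 i ^+ 2))) ->
  (forall i, \int[P]_w (Z w ord0 i ^+ 2) <= c) ->
  `|\int[P]_w f (Z w) - \int[P]_w g (Z w)| <= e * (1 + k%:R * c).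
Proof.
move=> cf fB tg e0 fg iZ EZ.
have fi : P.-integrable setT (EFin \o (fun w => f (Z w))).
  apply: (@integrable_le_bounded _ _ _ P _ B) => //.
  exact: continuous_vector_measurable fB.
have gi := trig_poly_integrable tg.
have iS : P.-integrable setT (EFin \o (fun w => \sum_i Z w ord0 i ^+ 2)).
  rewrite (_ : _ \o _ = fun w => \sum_i (Z w ord0 i ^+ 2)%:E)%E; last first.
    by apply/funext => w /=; rewrite sumEFin.
  by apply: integrable_sum => // i _; exact: iZ.
have ES : \int[P]_w (\sum_i Z w ord0 i ^+ 2) = \sum_i \int[P]_w (Z w ord0 i ^+ 2).
  apply: EFin_inj; rewrite EFin_Rintegral// -sumEFin.
  under eq_integral do rewrite -sumEFin.
  rewrite integral_sum//.
  by apply: eq_bigr => i _; rewrite EFin_Rintegral//; exact: iZ.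
have i1S : P.-integrable setT (EFin \o (fun w => 1 + \sum_i Z w ord0 i ^+ 2)).
  by apply: integrableD_EFin => //; exact: finite_measure_integrable_cst.
rewrite -RintegralB//.
apply: le_trans (Rintegral_dominated _ (integrableZ_EFin e i1S) _) _ => //.
  exact: integrableB_EFin.
rewrite RintegralZl// RintegralD//; last exact: finite_measure_integrable_cst.
rewrite Rintegral_cstT ES ler_wpM2l// lerD2l.
have -> : k%:R * c = \sum_(i < k) c by rewrite sumr_const card_ord mulr_natl.
by apply: ler_sum => i _; exact: EZ.
Qed.

End random_vectors.

(** * The gap between the partial sums and the Wiener process *)

Section invariance.
Context {R : realType} {d d' : measure_display}.
Context {T : measurableType d} {T' : measurableType d'}.
Variables (P : probability T R) (P' : probability T' R).
Variables (X : nat -> {RV P >-> R}) (W : R -> T' -> R).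
Hypothesis Xindep : independent_family P [set j | (1 <= j)%N] X.
Hypothesis Xcentered : forall j, (1 <= j)%N -> 'E_P[X j]%E = 0%E.
Hypothesis Xsquare : forall j, (1 <= j)%N -> (X j : T -> R) \in Lfun P 2%:E.
Hypothesis s_gt0 : \forall n \near \oo, 0 < sum_sd P X n.
Hypothesis Xlindeberg : lindeberg_condition P X.
Hypothesis Ww : standard_wiener P' W.

Lemma lindeberg_sum_cvg0 (e : R) : 0 < e -> lindeberg_sum X e n @[n --> \oo] --> 0.
Proof. by move=> e0; exact: Xlindeberg. Qed.

Section times.
Variables (k : nat) (m : nat -> 'I_k -> nat).
Hypothesis mn : forall n i, (m n i <= n)%N.

Definition sum_row (n : nat) (w : T) : 'rV[R]_k :=
  \row_i (partial_sum X (m n i) w / sum_sd P X n).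

Definition wiener_row (n : nat) (w : T') : 'rV[R]_k :=
  \row_i (W (var_clock X n (m n i)) w - W 0 w).

Lemma sum_row_measurable n i :
  measurable_fun setT (fun w => sum_row n w ord0 i).
Proof.
under eq_fun do rewrite mxE.
by apply: measurable_funM => //; exact: measurable_partial_sum.
Qed.

Lemma wiener_row_measurable n i :
  measurable_fun setT (fun w => wiener_row n w ord0 i).
Proof.
under eq_fun do rewrite mxE.
have [v0 v1] := var_clock_itv X (mn n i).
by apply: (wiener_increment_measurable Ww).
Qed.

Lemma sum_row_sqr n i : 0 < sum_sd P X n ->
  P.-integrable setT (EFin \o (fun w => sum_row n w ord0 i ^+ 2)) /\
  \int[P]_w (sum_row n w ord0 i ^+ 2) <= 4 * expR 1.
Proof.
move=> s0; have [iS ES] := partial_sum_sqr Xindep Xcentered Xsquare (m n i).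
have E w : sum_row n w ord0 i ^+ 2 =
    (sum_sd P X n ^+ 2)^-1 * partial_sum X (m n i) w ^+ 2.
  by rewrite mxE expr_div_n mulrC.
split.
  under [X in integrable _ _ X]eq_fun do rewrite /= E.
  exact: integrableZ_EFin.
under eq_Rintegral do rewrite E.
rewrite RintegralZl// ES sum_sd_sqr mulrC.
apply: le_trans (var_clock_itv X (mn n i)).2 _.
have : 1 <= expR 1 :> R by rewrite -expR0 ler_expR.
by lra.
Qed.

Lemma wiener_row_sqr n i :
  P'.-integrable setT (EFin \o (fun w => wiener_row n w ord0 i ^+ 2)) /\
  \int[P']_w (wiener_row n w ord0 i ^+ 2) <= 4 * expR 1.
Proof.
have [v0 v1] := var_clock_itv X (mn n i).
have G := wiener_increment Ww (lexx 0) v0 v1; rewrite subr0 in G.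
have [iW EW] := gaussian_sqr_le G v1.
have E w : wiener_row n w ord0 i ^+ 2 = (W (var_clock X n (m n i)) w - W 0 w) ^+ 2.
  by rewrite mxE.
split; first by under [X in integrable _ _ X]eq_fun do rewrite /= E.
by under eq_Rintegral do rewrite E.
Qed.

(** Both linear combinations are sums over the n steps of the row, with weight
    c j = the sum of the u i such that j < m n i. *)
Lemma cos_row_cvg (u : 'I_k -> R) (b : R) :
  (\int[P]_w cos (\sum_i u i * sum_row n w ord0 i + b) -
   \int[P']_w cos (\sum_i u i * wiener_row n w ord0 i + b)) @[n --> \oo] --> 0.
Proof.
apply/cvgr0Pnorm_le => eps eps0.
(* The three error terms of the estimate are made at most eps / 3 each. *)
pose th : R := \sum_i `|u i| + 1.
have th0 : 0 < th by rewrite ltr_wpDl// sumr_ge0.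
have th2 : 0 < th ^+ 2 by rewrite exprn_gt0.
pose K : R := 25 * expR 2.
have K0 : 0 < K by rewrite mulr_gt0 ?expR_gt0.
pose e : R := eps / (6 * th ^+ 2).
have e0 : 0 < e by rewrite divr_gt0// mulr_gt0.
pose r : R := Num.min th^-1 (eps / (6 * K * th ^+ 3)).
have Kth : 0 < 6 * K * th ^+ 3 by rewrite !mulr_gt0// exprn_gt0.
have r0 : 0 < r by rewrite lt_min invr_gt0 th0 divr_gt0.
have thr : th * r <= 1.
  apply: le_trans (_ : _ <= th * th^-1) _; last by rewrite divff ?gt_eqF.
  by rewrite ler_wpM2l ?(ltW th0)// ge_min lexx.
have r3 : 2 * K * th ^+ 3 * r <= eps / 3.
  apply: le_trans (_ : _ <= 2 * K * th ^+ 3 * (eps / (6 * K * th ^+ 3))) _.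
    rewrite ler_wpM2l ?ge_min ?lexx ?orbT//.
    by rewrite !mulr_ge0 ?exprn_ge0 ?(ltW K0) ?(ltW th0).
  by rewrite le_eqVlt; apply/orP; left; apply/eqP; field; rewrite !gt_eqF.
have eth0 : 0 < e / th by rewrite divr_gt0.
have r20 : 0 < r / 2 by rewrite divr_gt0.
have rr0 : 0 < r ^+ 2 / 2 by rewrite divr_gt0// exprn_gt0.
have /cvgr0Pnorm_le/(_ e e0) L1 := lindeberg_sum_cvg0 eth0.
have /cvgr0Pnorm_le/(_ _ rr0) L2 := lindeberg_sum_cvg0 r20.
near=> n.
have s0 : 0 < sum_sd P X n by near: n; exact: s_gt0.
have l1 : lindeberg_sum X (e / th) n <= e.
  by apply: le_trans (ler_norm _) _; near: n.
have l2 : lindeberg_sum X (r / 2) n <= r ^+ 2 / 2.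
  by apply: le_trans (ler_norm _) _; near: n.
have rn q : (1 <= q <= n)%N ->
    (\int[P]_w (X q w ^+ 2)) / sum_var P X n <= r ^+ 2.
  move=> qn; apply: le_trans (variance_le_lindeberg Xsquare qn s0 r20) _.
  by rewrite expr_div_n; have := sqr_ge0 r; lra.
pose c (j : nat) : R := \sum_i u i * (j < m n i)%:R.
have cth j : `|c j| <= th.
  apply: le_trans (ler_norm_sum _ _ _) _.
  apply: le_trans (_ : _ <= \sum_i `|u i|) _; last by rewrite lerDl.
  apply: ler_sum => i _; rewrite normrM ler_piMr//.
  by case: (j < m n i)%N; rewrite ?normr0 ?normr1.
have sumE w : \sum_i u i * sum_row n w ord0 i =
    \sum_(0 <= j < n) c j / sum_sd P X n * X j.+1 w.
  under [RHS]eq_bigr do rewrite /c !mulr_suml.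
  rewrite exchange_big/=; apply: eq_bigr => i _.
  rewrite mxE /partial_sum big_add1/= (sum_nat_prefix (fun j => X j.+1 w) (mn n i)).
  rewrite mulr_suml mulr_sumr; apply: eq_bigr => j _.
  by ring.
have wE w : \sum_i u i * wiener_row n w ord0 i =
    \sum_(0 <= j < n) c j * (W (var_clock X n j.+1) w - W (var_clock X n j) w).
  under [RHS]eq_bigr do rewrite /c !mulr_suml.
  rewrite exchange_big/=; apply: eq_bigr => i _.
  rewrite mxE; have t0 : var_clock X n 0 = 0.
    by rewrite /var_clock sum_var0 mul0r.
  have := wiener_telescope W (var_clock X n) w (mn n i); rewrite t0 => ->.
  rewrite mulr_sumr; apply: eq_bigr => j _.
  by rewrite mulrA.
under eq_Rintegral do rewrite sumE.
under [X in _ - X]eq_Rintegral do rewrite wE.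
have := row_cf_le Xindep Xcentered Xsquare Ww s0 th0 e0 cth rn (ltW r0) thr b.
move=> /le_trans; apply.
have h1 : 2 * e * th ^+ 2 = eps / 3 by rewrite /e; field; rewrite gt_eqF.
have h2 : 2 * th ^+ 2 * lindeberg_sum X (e / th) n <= 2 * e * th ^+ 2.
  by have := ler_wpM2l (ltW th2) l1; lra.
by move: r3 h2; rewrite h1 /K; lra.
Unshelve. all: by end_near. Qed.

Lemma trig_poly_row_cvg (g : 'rV[R]_k -> R) : trig_poly g ->
  (\int[P]_w g (sum_row n w) - \int[P']_w g (wiener_row n w)) @[n --> \oo] --> 0.
Proof.
have iY n (h : 'rV[R]_k -> R) (th : trig_poly h) :=
  trig_poly_integrable P (sum_row_measurable n) th.
have iW n (h : 'rV[R]_k -> R) (th : trig_poly h) :=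
  trig_poly_integrable P' (wiener_row_measurable n) th.
elim => [u b|f h tf fc th hc|c f tf fc].
- exact: cos_row_cvg.
- rewrite (_ : (fun n => _) = fun n =>
     (\int[P]_w f (sum_row n w) - \int[P']_w f (wiener_row n w)) +
     (\int[P]_w h (sum_row n w) - \int[P']_w h (wiener_row n w))).
    by rewrite -[0]addr0; exact: cvgD.
  by apply/funext => n; rewrite !RintegralD ?iY ?iW//; ring.
- rewrite (_ : (fun n => _) = fun n =>
     c * (\int[P]_w f (sum_row n w) - \int[P']_w f (wiener_row n w))).
    by rewrite -[0](mulr0 c); apply: cvgMr.
  by apply/funext => n; rewrite !RintegralZl ?iY ?iW// mulrBr.
Qed.

Lemma continuous_row_cvg (f : 'rV[R]_k -> R) (B : R) :
  continuous f -> (forall x, `|f x| <= B) ->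
  (\int[P]_w f (sum_row n w) - \int[P']_w f (wiener_row n w)) @[n --> \oo] --> 0.
Proof.
move=> cf fB; apply/cvgr0Pnorm_le => eps eps0.
pose C : R := 1 + k%:R * (4 * expR 1).
have C0 : 0 < C by rewrite ltr_wpDr// !mulr_ge0 ?expR_ge0.
pose e : R := eps / 3 / C.
have e0 : 0 < e by rewrite !divr_gt0.
have [g tg fg] := trig_poly_approx cf fB e0.
have e30 : 0 < eps / 3 by rewrite divr_gt0.
have /cvgr0Pnorm_le/(_ _ e30) gap := trig_poly_row_cvg tg.
near=> n.
have s0 : 0 < sum_sd P X n by near: n; exact: s_gt0.
have hY := trig_poly_approx_mean (P := P) (sum_row_measurable n) cf fB tg (ltW e0) fg
  (fun i => (sum_row_sqr i s0).1) (fun i => (sum_row_sqr i s0).2).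
have hW := trig_poly_approx_mean (P := P') (wiener_row_measurable n) cf fB tg
  (ltW e0) fg (fun i => (wiener_row_sqr n i).1) (fun i => (wiener_row_sqr n i).2).
have hg : `|\int[P]_w g (sum_row n w) - \int[P']_w g (wiener_row n w)| <= eps / 3.
  by near: n.
have eC : e * (1 + k%:R * (4 * expR 1)) = eps / 3 by rewrite /e -/C divfK// gt_eqF.
rewrite eC in hY hW; rewrite distrC in hW.
move: hY hW hg; rewrite !ler_norml => /andP[? ?] /andP[? ?] /andP[? ?].
by apply/andP; split; lra.
Unshelve. all: by end_near. Qed.

End times.
End invariance.

(** * Convergence of the finite-dimensional distributions *)

Section limit.
Context {R : realType} {d : measure_display} {T : measurableType d}.
Variables (P : probability T R).

Lemma expectation_Rintegral (f : T -> R) : P.-integrable setT (EFin \o f) ->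
  'E_P[f]%E = (\int[P]_w f w)%:E.
Proof. by move=> fi; rewrite unlock EFin_Rintegral. Qed.

Lemma cvg_row (k : nat) (x : nat -> 'rV[R]_k) (y : 'rV[R]_k) :
  (forall i, x n ord0 i @[n --> \oo] --> y ord0 i) -> x n @[n --> \oo] --> y.
Proof.
move=> xy; apply/cvg_ballP => e e0.
have : \forall n \near \oo, forall i, ball (y ord0 i) e (x n ord0 i).
  by apply: filter_forall => i; have /cvg_ballP/(_ _ e0) := xy i.
by apply: filterS => n H; split => // i j; rewrite ord1.
Qed.

(** Continuity of the paths makes the vectors converge almost surely; dominated
    convergence does the rest. *)
Lemma wiener_row_limit (W : R -> T -> R) (Ww : standard_wiener P W) (k : nat)
    (f : 'rV[R]_k -> R) (B : R) (r : nat -> 'I_k -> R) (a : 'I_k -> R) :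
  continuous f -> (forall x, `|f x| <= B) ->
  (forall n i, 0 <= r n i /\ r n i <= 1) -> (forall i, 0 <= a i /\ a i <= 1) ->
  (forall i, r n i @[n --> \oo] --> a i) ->
  P.-integrable setT (EFin \o (fun w => f (\row_i W (a i) w))) /\
  (\int[P]_w f (\row_i (W (r n i) w - W 0 w)))%:E @[n --> \oo] -->
  (\int[P]_w f (\row_i W (a i) w))%:E.
Proof.
move=> cf fB r01 a01 ra.
have mr n i : measurable_fun setT (fun w => (\row_i (W (r n i) w - W 0 w)) ord0 i).
  under eq_fun do rewrite mxE.
  by have [? ?] := r01 n i; apply: (wiener_increment_measurable Ww).
have ma i : measurable_fun setT (fun w => (\row_i W (a i) w) ord0 i).
  under eq_fun do rewrite mxE.
  by have [? ?] := a01 i; apply: (wiener_measurable Ww).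
have ir n : P.-integrable setT (EFin \o (fun w => f (\row_i (W (r n i) w - W 0 w)))).
  apply: (@integrable_le_bounded _ _ _ P _ B) => //.
  exact: (continuous_vector_measurable (mr n) cf fB).
have ia : P.-integrable setT (EFin \o (fun w => f (\row_i W (a i) w))).
  apply: (@integrable_le_bounded _ _ _ P _ B) => //.
  exact: (continuous_vector_measurable ma cf fB).
split => //; rewrite EFin_Rintegral//.
under eq_fun do rewrite EFin_Rintegral//.
have path_cvg : {ae P, forall w, [set: T] w ->
    (f (\row_i (W (r n i) w - W 0 w)))%:E @[n --> \oo] -->
    (f (\row_i W (a i) w))%:E}.
  case: Ww => _ W0 _ _ Wc.
  apply: filterS2 W0 Wc => w W0 Wc _.
  apply/cvg_EFin; first by near=> n.
  apply: (@cvg_comp _ _ _ (fun n => \row_i (W (r n i) w - W 0 w)) f _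
    (nbhs (\row_i W (a i) w))); last exact: cf.
  apply: cvg_row => i; rewrite mxE.
  under eq_fun do rewrite mxE W0 subr0.
  have A01 (y : R) : 0 <= y -> y <= 1 -> `[0, 1]%classic y.
    by move=> y0 y1; rewrite /= in_itv/= y0.
  have [a0 a1] := a01 i.
  have /subspace_continuousP/(_ _ (A01 _ a0 a1)) Wai := Wc.
  apply: (cvg_comp (fun n => r n i) (W ^~ w) _ Wai) => U /= aU.
  have rU : \forall n \near \oo, `[0, 1]%classic (r n i) -> U (r n i) := ra i _ aU.
  apply: filterS rU => n; apply.
  by have [? ?] := r01 n i; exact: A01.
have dom : {ae P, forall w n, [set: T] w ->
    (`|(f (\row_i (W (r n i) w - W 0 w)))%:E| <= B%:E)%E}.
  by apply: aeW => w n _; rewrite /= lee_fin.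
have iB : P.-integrable setT (fun=> B%:E) by exact: finite_measure_integrable_cst.
by have [_ _] := @dominated_convergence _ _ _ P setT measurableT _ _ _
  (fun n => measurable_int _ (ir n)) (measurable_int _ ia) path_cvg iB dom.
Unshelve. all: by end_near. Qed.

End limit.

Theorem theorem3 (R : realType)
    (d : measure_display) (T : measurableType d) (P : probability T R)
    (X : nat -> {RV P >-> R})
    (Xindep : independent_family P [set j | (1 <= j)%N] X)
    (Xcentered : forall j, (1 <= j)%N -> 'E_P[X j]%E = 0%E)
    (Xsquare : forall j, (1 <= j)%N -> (X j : T -> R) \in Lfun P 2%:E)
    (s_gt0 : \forall n \near \oo, 0 < sum_sd P X n)
    (a : R -> R)
    (a_nondecr : {in `[0, 1] &, {homo a : x y / x <= y}})
    (a_lim : forall t : R, t \in `[0, 1] ->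
       sum_var P X (Num.truncn (n%:R * t)) / sum_var P X n @[n --> \oo] --> a t)
    (Xlindeberg : lindeberg_condition P X)
    (d' : measure_display) (T' : measurableType d') (P' : probability T' R)
    (W : R -> T' -> R) (Wwiener : standard_wiener P' W) :
  cvg_fdd P P' (sum_process P X) (fun t => W (a t)).
Proof.
move=> k t t01 f cf [M [_ fM]].
have fB x : `|f x| <= M + 1 by apply: fM => //; rewrite ltrDl.
pose m n (i : 'I_k) := Num.truncn (n%:R * t i).
have t_ge0 i : 0 <= t i by have := t01 i; rewrite in_itv/= => /andP[].
have mn n i : (m n i <= n)%N.
  rewrite -[leqRHS](natrK (R := R)); apply: le_truncn.
  by rewrite ler_piMr//; have := t01 i; rewrite in_itv/= => /andP[].
have rowE n w : \row_i sum_process P X n (t i) w = sum_row X m n w.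
  apply/rowP => i; rewrite !mxE /sum_process; case: ifPn => // nt1.
  have -> : m n i = 0%N.
    apply/eqP; rewrite -leqn0 /m leqNgt truncn_gt0//.
  by rewrite /partial_sum big_geq// mul0r.
have r01 n i := var_clock_itv X (mn n i).
have a01 i : 0 <= a (t i) /\ a (t i) <= 1.
  split.
    by apply: (cvgr_to_ge (a_lim _ (t01 i))); near=> n; exact: (r01 n i).1.
  by apply: (cvgr_to_le (a_lim _ (t01 i))); near=> n; exact: (r01 n i).2.
have [ia Wlim] := wiener_row_limit Wwiener cf fB r01 a01 (fun i => a_lim _ (t01 i)).
have gap := continuous_row_cvg Xindep Xcentered Xsquare s_gt0 Xlindeberg Wwiener
  mn cf fB.
rewrite (expectation_Rintegral ia).
under eq_fun => n.
  under [X in expectation _ X]eq_fun do rewrite rowE.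
  rewrite expectation_Rintegral; last first.
    apply: (@integrable_le_bounded _ _ _ P _ (M + 1)) => //.
    exact: (continuous_vector_measurable (sum_row_measurable X m n) cf fB).
  over.
apply/cvg_EFin; first by near=> n.
have /fine_cvgP[_ Wlim'] := Wlim.
exact: cvg_sub0 gap Wlim'.
Unshelve. all: by end_near. Qed.
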